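(* If $X$ is a computable $K_\sigma$-space, then $\mathsf{C}_X$ is low computable.
   Context: Baire space is $\mathbb{N}^{\mathbb{N}}$, with its usual product topology, a fixed computable bijective pairing $\langle\cdot,\cdot\rangle$ and the canonical countable tupling $\langle p_0,p_1,p_2,\ldots\rangle$ on it. Computability of partial functions $F:\subseteq\mathbb{N}^{\mathbb{N}}\to\mathbb{N}^{\mathbb{N}}$ is meant via (type-2) Turing machines. A representation of a set $X$ is a surjective partial function $\delta:\subseteq\mathbb{N}^{\mathbb{N}}\to X$; $(X,\delta)$ is a represented space. A realizer of a partial multi-valued function $f:\subseteq(X,\delta_X)\rightrightarrows(Y,\delta_Y)$ is a single-valued $F:\subseteq\mathbb{N}^{\mathbb{N}}\to\mathbb{N}^{\mathbb{N}}$ with $\delta_YF(p)\in f\delta_X(p)$ for all $p\in\mathrm{dom}(f\delta_X)$; $f$ is $(\delta_X,\delta_Y)$-computable if it has a computable realizer. Sierpiński space $\mathbb{S}=\{0,1\}$ has topology $\{\emptyset,\{1\},\{0,1\}\}$ and representation $\delta_{\mathbb{S}}(p)=1\iff(\exists n)\,p(n)=0$. For a represented space $(X,\delta)$, a set $U\subseteq X$ is open if its characteristic function $\chi_U:X\to\mathbb{S}$ has a continuous realizer, and closed sets are the complements of open sets. $\mathcal{A}_-(X)$ is the set of closed subsets of $X$ with the representation $\psi_-^X$: a name of $A$ is a name of $\chi_{X\setminus A}$ in the canonical function space representation $[\delta\to\delta_{\mathbb{S}}]$ (a name $nq$, $n\in\mathbb N$, $q\in\mathbb{N}^{\mathbb{N}}$,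 names $\chi$ iff $r\mapsto\Phi_n\langle q,r\rangle$ is a realizer of $\chi$, where $\Phi_n$ is the $n$-th computable partial function on $\mathbb{N}^{\mathbb{N}}$). Closed choice is $\mathsf{C}_X:\subseteq\mathcal{A}_-(X)\rightrightarrows X,\ A\mapsto A$ with domain the non-empty closed sets (any point of $A$ is an admissible output). A computable metric space $(X,d,\alpha)$ is a separable metric space with a numbering $\alpha:\mathbb{N}\to X$ of a countable dense subset such that $(i,j)\mapsto d(\alpha(i),\alpha(j))$ is computable; it is represented by its Cauchy representation ($p$ names $\lim_i\alpha(p(i))$ provided $d(\alpha(p(i)),\alpha(p(j)))<2^{-j}$ for all $i>j$). Rational open balls are balls with center in $\mathrm{range}(\alpha)$ and rational radius. A $\kappa$-name of a compact $K\subseteq X$ is a list of (codes of) all finite covers of $K$ by rational open balls each of which has non-empty intersection with $K$; $K$ is computably compact if it has a computable $\kappa$-name, and a sequence $(K_i)_i$ of such sets is computable if $\kappa$-names of the $K_i$ can be computed uniformly in $i$. A computable $K_\sigma$-space is a computable metric space $X$ for which there is a computable sequence $(K_i)_{i\in\mathbb{N}}$ of non-empty computably compact sets with $X=\bigcup_{i=0}^\infty K_i$. Let $(U_n)_{n\in\mathbb{N}}$ be a standard enumeration of the c.e. open subsets of $\mathbb{N}^{\mathbb{N}}$ (e.g. $U_n=\bigcup_{w\in W_n}w\mathbb{N}^{\mathbb{N}}$ with $W_n$ the $n$-th c.e. set of finite words over $\mathbb{N}$). The Turing jump operator $J:\mathbb{N}^{\mathbb{N}}\to\mathbb{N}^{\mathbb{N}}$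 is $J(p)(n)=1$ if $p\in U_n$ and $J(p)(n)=0$ otherwise; it is injective and $J^{-1}$ denotes its partial inverse. $\lim:\subseteq\mathbb{N}^{\mathbb{N}}\to\mathbb{N}^{\mathbb{N}}$, $\langle p_0,p_1,\ldots\rangle\mapsto\lim_{i\to\infty}p_i$ (usual Baire topology). For a represented space $(X,\delta)$ the low representation is $\delta^\vee:=\delta\circ J^{-1}\circ\lim$. $f:\subseteq X\rightrightarrows Y$ is low computable if it is $(\delta_X,\delta_Y^\vee)$-computable. *)

(* Defs.v *)
From HB Require Import structures.
From mathcomp Require Import all_boot all_order all_algebra.
From mathcomp Require Import all_classical all_reals all_analysis.
Set Implicit Arguments.
Unset Strict Implicit.
Unset Printing Implicit Defensive.
Import Order.TTheory GRing.Theory Num.Theory.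
Import numFieldNormedType.Exports.

Local Open Scope classical_set_scope.

(* Partial multi-valued maps f :⊆ A ⇉ B are functions A -> set B, with domain
   {a | f a !=set0}; partial single-valued maps are those with
   [single_valued f]. In particular a representation of X is a single-valued
   map baire -> set X. *)

Definition baire := {ptws nat -> nat}.

Definition mdom (A B : Type) (f : A -> set B) : set A := [set a | f a !=set0].

Definition single_valued (A B : Type) (f : A -> set B) : Prop :=
  forall a, is_subset1 (f a).

Definition graph (A B : Type) (f : A -> B) : A -> set B :=
  fun a => [set f a].

(* composition of single-valued partial maps: g \o f *)
Definition comp_pfun (A B C : Type) (g : B -> set C) (f : A -> set B) :
  A -> set C := fun a => [set c | exists2 b, f a b & g b c].

(* partial inverse of an (injective) total map *)
Definition pinv (A B : Type) (f : A -> B) : B -> set A :=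
  fun b => [set a | f a = b].

(* -------------------------------------------------------------------------- *)
(* Pairings                                                                   *)
(* -------------------------------------------------------------------------- *)

(* npair i j + 1 = 2^i (2j + 1); compatible with the list coding of the
   library: CodeSeq.code (i :: s) = (npair i (CodeSeq.code s)).+1 *)
Definition npair (i j : nat) : nat := (2 ^ i * j.*2.+1).-1.

Definition nunpair (n : nat) : nat * nat :=
  let i := logn 2 n.+1 in (i, (n.+1 %/ 2 ^ i)./2).

Lemma npairK i j : nunpair (npair i j) = (i, j).
Proof.
have gt0 : 0 < 2 ^ i * j.*2.+1 by rewrite muln_gt0 expn_gt0.
rewrite /nunpair /npair prednK // lognM ?expn_gt0 // pfactorK //.
rewrite lognE /= dvdn2 /= odd_double /= addn0.
by rewrite mulKn ?expn_gt0 //= uphalf_double.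
Qed.

Lemma nunpairK n : npair (nunpair n).1 (nunpair n).2 = n.
Proof.
rewrite /nunpair /npair /=.
have [k ok En] := @pfactor_coprime 2 n.+1 isT (ltn0Sn n).
set i := logn 2 n.+1 in En *; rewrite En mulnK ?expn_gt0 //.
rewrite coprime2n in ok; have := odd_double_half k; rewrite ok add1n => ->.
by rewrite mulnC -En.
Qed.

Definition bpair (p q : baire) : baire :=
  fun n => if odd n then q n./2 else p n./2.

(* the components p_i of a sequence <p_0, p_1, ...> *)
Definition bproj (p : baire) (i : nat) : baire := fun j => p (npair i j).

(* -------------------------------------------------------------------------- *)
(* Type-2 Turing machines                                                     *)
(* -------------------------------------------------------------------------- *)

(* Machines are given, as in Weihrauch's books, by flowcharts over elementary
   tape operations: a program is a list of instructions, executed in order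
   unless a test jumps; the machine halts when it leaves the program. There is
   a one-way read-only input tape, a one-way write-only output tape, both with
   symbols in bool, and work tapes, two-way infinite, indexed by nat and with
   symbols in nat (0 is the blank). A program mentions only finitely many
   tapes and symbols. *)
Variant instr :=
| TapeLeft of nat            (* move the head of a work tape *)
| TapeRight of nat
| TapeWrite of nat & nat     (* TapeWrite i s : write s on tape i *)
| TapeTest of nat & nat & nat  (* TapeTest i s l : if tape i reads s goto l *)
| InNext                     (* advance on the input tape *)
| InTest of nat              (* InTest l : if the input symbol is true goto l *)
| OutWrite of bool.          (* append a symbol to the output *)

Definition program := seq instr.

(* cells to the left of the head (nearest first), scanned cell, cells to the
   right; cells that are not listed are blank *)
Definition tape : Type := seq nat * nat * seq nat.

Definition blank_tape : tape := ([::], 0, [::]).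

Definition tape_left (t : tape) : tape :=
  let: (l, c, r) := t in (behead l, head 0 l, c :: r).

Definition tape_right (t : tape) : tape :=
  let: (l, c, r) := t in (c :: l, head 0 r, behead r).

Definition tape_write (s : nat) (t : tape) : tape :=
  let: (l, _, r) := t in (l, s, r).

Definition tape_read (t : tape) : nat := t.1.2.

Record config := Config {
  pc : nat;
  in_pos : nat;
  work : nat -> tape;
  out : seq bool }.

Definition init_config : config := Config 0 0 (fun=> blank_tape) [::].

Definition upd_tape (w : nat -> tape) (i : nat) (f : tape -> tape) :
  nat -> tape := fun j => if j == i then f (w j) else w j.

Definition exec (input : nat -> bool) (op : instr) (c : config) : config :=
  let: Config l k w o := c in
  match op with
  | TapeLeft i => Config l.+1 k (upd_tape w i tape_left) o
  | TapeRight i => Config l.+1 k (upd_tape w i tape_right) o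
  | TapeWrite i s => Config l.+1 k (upd_tape w i (tape_write s)) o
  | TapeTest i s l' => Config (if tape_read (w i) == s then l' else l.+1) k w o
  | InNext => Config l.+1 k.+1 w o
  | InTest l' => Config (if input k then l' else l.+1) k w o
  | OutWrite b => Config l.+1 k w (rcons o b)
  end.

Definition step (M : program) (input : nat -> bool) (c : config) : config :=
  if onth M (pc c) is Some op then exec input op c else c.

Definition run (M : program) (input : nat -> bool) (t : nat) : config :=
  iter t (step M input) init_config.

Definition halts (M : program) (input : nat -> bool) : Prop :=
  exists t, size M <= pc (run M input t).

(* p is written on a tape as 1^(p 0) 0 1^(p 1) 0 1^(p 2) 0 ..., with true for 1
   and false for 0; sep p i is the position of the i-th 0 *)
Definition sep (p : baire) (i : nat) : nat := i + \sum_(l < i.+1) p l.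

Definition tape_of (p : baire) (j : nat) : bool :=
  ~~ [exists i : 'I_j.+1, j == sep p i].

(* Goedel numbering; every instruction has at least one number *)
Definition instr_of (c : nat) : instr :=
  match CodeSeq.decode c with
  | [:: 0; i] => TapeLeft i
  | [:: 1; i] => TapeRight i
  | [:: 2; i; s] => TapeWrite i s
  | [:: 3; i; s; l] => TapeTest i s l
  | [:: 4; l] => InTest l
  | [:: 5; b] => OutWrite (b != 0)
  | _ => InNext
  end.

Definition machine (n : nat) : program := map instr_of (CodeSeq.decode n).

(* the n-th computable partial function on Baire space; its domain consists of
   the inputs on which the machine writes an infinite sequence of the form
   tape_of q, where q is unique since tape_of is injective *)
Definition Phi (n : nat) (p : baire) : set baire :=
  [set q | forall k, exists t,
     let o := out (run (machine n) (tape_of p) t) in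
     k < size o /\ nth false o k = tape_of q k].

(* a computable F is computed on its domain; the machine may converge elsewhere *)
Definition computable_pfun (F : baire -> set baire) : Prop :=
  exists n, forall p, F p `<=` Phi n p.

Definition computable_point (q : baire) : Prop :=
  computable_pfun (graph (fun=> q)).

(* -------------------------------------------------------------------------- *)
(* Represented spaces                                                         *)
(* -------------------------------------------------------------------------- *)

Section represented_spaces.
Variables (X Y : Type) (dX : baire -> set X) (dY : baire -> set Y).

Definition realizer (F : baire -> set baire) (f : X -> set Y) : Prop :=
  single_valued F /\
  forall p x, dX p x -> mdom f x ->
    exists2 q, F p q & exists2 y, dY q y & f x y.

Definition computable (f : X -> set Y) : Prop :=
  exists2 F, computable_pfun F & realizer F f.

Definition continuous_pfun (F : baire -> set baire) : Prop :=
  exists2 f : baire -> baire,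
    {within mdom F, continuous f} & forall p, F p `<=` [set f p].

Definition continuously_realizable (f : X -> set Y) : Prop :=
  exists2 F, continuous_pfun F & realizer F f.

Definition rep_prod : baire -> set (X * Y) :=
  fun p => [set z | exists q r, [/\ p = bpair q r, dX q z.1 & dY r z.2]].

(* [dX -> dY]; p = nq with n = p 0 *)
Definition rep_fun : baire -> set (X -> Y) :=
  fun p => [set f | let q : baire := fun k => p k.+1 in
    realizer (fun r => Phi (p 0) (bpair q r)) (graph f)].

End represented_spaces.

Definition rep_nat : baire -> set nat := fun p => [set p 0].

(* Sierpinski space, with carrier bool *)
Definition rep_sierp : baire -> set bool :=
  fun p => [set b | b = true <-> exists n, p n = 0].

Definition char_fun (X : Type) (U : set X) : X -> bool := fun x => `[< U x >].

Definition rep_open (X : Type) (dX : baire -> set X) (U : set X) : Prop :=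
  continuously_realizable dX rep_sierp (graph (char_fun U)).

Definition rep_closed (X : Type) (dX : baire -> set X) (A : set X) : Prop :=
  rep_open dX (~` A).

(* representation of the hyperspace of closed sets by negative information *)
Definition psi_minus (X : Type) (dX : baire -> set X) : baire -> set (set X) :=
  fun p => [set A | rep_closed dX A /\
                    rep_fun dX rep_sierp p (char_fun (~` A))].

Definition closed_choice (X : Type) (dX : baire -> set X) : set X -> set X :=
  fun A => [set x | rep_closed dX A /\ A x].

(* -------------------------------------------------------------------------- *)
(* Jump, limit, low computability                                             *)
(* -------------------------------------------------------------------------- *)

(* n-th c.e. set of finite words: those on whose code the n-th machine halts *)
Definition ce_words (n : nat) : set (seq nat) :=
  [set w | let p : baire := fun k => if k is 0 then CodeSeq.code w else 0 in
           halts (machine n) (tape_of p)].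

Definition ce_open (n : nat) : set baire :=
  [set p | exists2 w, ce_words n w & w = mkseq p (size w)].

Definition jump (p : baire) : baire := fun n => `[< ce_open n p >] : nat.

Definition baire_lim (p : baire) : set baire := [set q | bproj p @ \oo --> q].

Definition rep_low (X : Type) (dX : baire -> set X) : baire -> set X :=
  comp_pfun dX (comp_pfun (pinv jump) baire_lim).

Definition low_computable (X Y : Type) (dX : baire -> set X)
    (dY : baire -> set Y) (f : X -> set Y) : Prop :=
  computable dX (rep_low dY) f.

(* -------------------------------------------------------------------------- *)
(* Computable metric spaces                                                   *)
(* -------------------------------------------------------------------------- *)

Local Open Scope ring_scope.

(* numbering of the rationals *)
Definition rat_of (n : nat) : rat :=
  let: (k, m) := nunpair n in let: (i, j) := nunpair k in
  (i%:R - j%:R) / m.+1%:R.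

Section computable_metric.
Variables (R : realType) (X : metricType R) (alpha : nat -> X).

Definition cauchy_rep : baire -> set X :=
  fun p => [set x |
    (forall i j, (j < i)%N -> mdist (alpha (p i)) (alpha (p j)) < 2 ^- j) /\
    (fun i => alpha (p i)) @ \oo --> x].

(* the ball with center alpha i and radius rat_of j, where k = <i, j>; it is
   empty if rat_of j <= 0 *)
Definition rball (k : nat) : set X :=
  let: (i, j) := nunpair k in ball (alpha i) (ratr (rat_of j)).

Definition min_cover_code (K : set X) (c : nat) : Prop :=
  let s := CodeSeq.decode c in
  K `<=` \bigcup_(k in [set` s]) rball k /\
  forall k, k \in s -> rball k `&` K !=set0.

Definition kappa : baire -> set (set X) :=
  fun p => [set K | compact K /\
                    forall c, (exists n, p n = c) <-> min_cover_code K c].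

Definition computably_compact (K : set X) : Prop :=
  exists2 p, computable_point p & kappa p K.

End computable_metric.

(* Cauchy representation of the real numbers *)
Definition rep_real (R : realType) : baire -> set R :=
  @cauchy_rep R R^o (fun n => ratr (rat_of n)).

Definition computable_metric_space (R : realType) (X : metricType R)
    (alpha : nat -> X) : Prop :=
  dense (range alpha) /\
  computable (rep_prod rep_nat rep_nat) (@rep_real R)
    (graph (fun ij => mdist (alpha ij.1) (alpha ij.2))).

Definition computable_Ksigma_space (R : realType) (X : metricType R)
    (alpha : nat -> X) : Prop :=
  computable_metric_space alpha /\
  exists K : nat -> set X,
    [/\ forall i, K i !=set0,
        forall i, computably_compact alpha (K i),
        computable rep_nat (kappa alpha) (graph K) &
        \bigcup_i K i = [set: X]].

(* Main.v *)
Require Import Defs.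
From mathcomp Require Import all_boot all_order all_algebra.
From mathcomp Require Import all_classical all_reals all_analysis.
From mathcomp Require Import zify ring lra.

Set Implicit Arguments.
Unset Strict Implicit.
Unset Printing Implicit Defensive.

(** The idea is the uniform low basis theorem, run on trees of names.

    Fix a name [p] of a closed set [A] and a piece [K_i].  Let level [k] of a
    tree of words branch over the centres of the first cover in the kappa-name
    of [K_i] all of whose balls have radius at most [2^-(k+2)], and remove a
    word once a simulation has shown that two of its centres are too far apart,
    or that points with names extending it are not in [A].  Every point of [A] in
    [K_i] has a name that is a branch of this tree ([name_in_product]).
    Conversely a branch is a name of such a point ([product_name], [outsideP]):
    the balls meet the compact set [K_i], so the limit exists although [X] need
    not be complete.  The tree is finitely
    branching, so by Koenig's lemma it has no branch if and only if this is
    refuted at some finite stage ([nonempty_piece], [empty_piece_kills]); the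
    same holds after the further removal of the words that enter any of
    finitely many of the c.e. open sets [U_m = ce_open m].

    Let [i] be least such that the tree of [K_i] has a branch, and decide in the
    order of [n] whether [U_n] can be avoided together with the sets avoided
    before: bit [n] is 0 if it can and 1 otherwise.  By compactness some branch
    [r] avoids all [U_n] with bit 0, and it must enter all those with bit 1, so
    the sequence of bits is the jump of [r] ([low_point]).  To output in the
    limit the jump of [r], rather than [r], is what low computability asks.
    Each bit depends on finitely many c.e. events, hence is the limit of its
    guesses at stage [t], which take a tree to have a branch as long as the
    contrary has not been seen by stage [t] ([output_lim]).

    The guess written at position [<t, n>] is a function of a finite prefix of
    [p], by bounded search and step-bounded simulation only.  What has to be
    known about machines is therefore this: a class of functions on numbers that
    is closed under pairing, composition and iteration can be applied by one
    machine to all prefixes of its input in turn ([stream_computable]), and this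
    class contains a step-bounded simulation of all machines
    ([codecomp_sim]). *)

(** * Unary tapes *)

Definition unary (s : seq nat) : seq bool :=
  flatten [seq rcons (nseq n true) false | n <- s].

Lemma unary_cat s1 s2 : unary (s1 ++ s2) = unary s1 ++ unary s2.
Proof. by rewrite /unary map_cat flatten_cat. Qed.

Lemma unary_rcons s n : unary (rcons s n) = unary s ++ rcons (nseq n true) false.
Proof. by rewrite -cats1 unary_cat /unary /= cats0. Qed.

Lemma mkseqS (p : baire) n : mkseq p n.+1 = rcons (mkseq p n) (p n).
Proof. by rewrite /mkseq -[n.+1]addn1 iotaD map_cat cats1. Qed.

Definition entry_pos (p : baire) (n : nat) : nat := size (unary (mkseq p n)).

Lemma entry_posS p n : entry_pos p n.+1 = entry_pos p n + (p n).+1.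
Proof. by rewrite /entry_pos mkseqS unary_rcons size_cat size_rcons size_nseq. Qed.

Lemma leq_entry_pos p m n : m <= n -> entry_pos p m <= entry_pos p n.
Proof.
move=> /subnK <-; elim: (n - m) => [//|k IH].
by rewrite addSn entry_posS (leq_trans IH) // leq_addr.
Qed.

Lemma entry_pos_ge p n : n <= entry_pos p n.
Proof. by elim: n => // n IH; rewrite entry_posS addnS ltnS (leq_trans IH) ?leq_addr.
  Qed.

Lemma sepE p i : sep p i = entry_pos p i + p i.
Proof.
have -> : entry_pos p i = i + \sum_(l < i) p l.
  elim: i => [|i IH]; first by rewrite big_ord0.
  by rewrite entry_posS IH big_ord_recr /=; lia.
by rewrite /sep big_ord_recr /=; lia.
Qed.

(** The symbols of entry [n] start at [entry_pos p n], and the separator that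
    ends them is the only false one among them. *)
Lemma tape_ofE p n d : d <= p n -> tape_of p (entry_pos p n + d) = (d != p n).
Proof.
move=> le_d; rewrite /tape_of; congr negb; apply/existsP/eqP => [[i /eqP]|->].
  rewrite sepE => E; case: (ltngtP i n) => [lt_in|lt_ni|ein].
  - by have := leq_entry_pos p lt_in; rewrite entry_posS; lia.
  - by have := leq_entry_pos p lt_ni; rewrite entry_posS; lia.
  - by move: E; rewrite ein; lia.
have lt_n : n < (entry_pos p n + p n).+1.
  by rewrite ltnS (leq_trans (entry_pos_ge p n)) ?leq_addr.
by exists (Ordinal lt_n); rewrite sepE.
Qed.

Lemma nth_unary (p : baire) n j : j < entry_pos p n ->
  nth false (unary (mkseq p n)) j = tape_of p j.
Proof.
rewrite /entry_pos; elim: n j => // n IH j.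
rewrite mkseqS unary_rcons nth_cat size_cat size_rcons size_nseq => lt_j.
case: ltnP => [/IH//|le_j].
rewrite -(subnKC le_j) addKn nth_rcons size_nseq nth_nseq.
have le_d : j - size (unary (mkseq p n)) <= p n by lia.
by rewrite tape_ofE //; case: ltngtP le_d.
Qed.

Definition scan (x : nat * seq nat) (b : bool) : nat * seq nat :=
  if b then (x.1.+1, x.2) else (0, x.1 :: x.2).

Definition decode_unary (b : seq bool) : seq nat := rev (foldl scan (0, [::]) b).2.

Lemma foldl_scan_true k x : foldl scan x (nseq k true) = (x.1 + k, x.2).
Proof.
elim: k x => [|k IH] x /=; first by rewrite addn0; case: x.
by rewrite IH /= addnS.
Qed.

Lemma foldl_scan_unary s v : foldl scan (0, v) (unary s) = (0, catrev s v).
Proof.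
elim: s v => //= n s IH v; rewrite /unary /= -/(unary s) foldl_cat.
by rewrite -cats1 foldl_cat foldl_scan_true /= IH.
Qed.

(** The decoder drops an incomplete last entry, so that every prefix of a tape
    decodes to a prefix of the sequence. *)
Lemma decode_unary_tape_of (p : baire) N : exists2 n,
  decode_unary (mkseq (tape_of p) N) = mkseq p n &
  entry_pos p n <= N < entry_pos p n.+1.
Proof.
have [n /andP[le_n lt_n]] : exists n, entry_pos p n <= N < entry_pos p n.+1.
  elim: N => [|N [n /andP[le_n lt_n]]]; first by exists 0; rewrite entry_posS.
  have [lt_N|ge_N] := ltnP N.+1 (entry_pos p n.+1).
    by exists n; rewrite lt_N; lia.
  by exists n.+1; rewrite (entry_posS p n.+1); lia.
exists n; last by rewrite le_n.
have -> : mkseq (tape_of p) N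
          = unary (mkseq p n) ++ nseq (N - entry_pos p n) true.
  apply: (@eq_from_nth _ false) => [|i].
    by rewrite size_mkseq size_cat size_nseq -/(entry_pos p n) subnKC.
  rewrite size_mkseq => lt_i; rewrite nth_mkseq // nth_cat -/(entry_pos p n).
  case: ltnP => [/nth_unary //|le_i].
  move: lt_n; rewrite entry_posS => lt_n.
  by rewrite -(subnKC le_i) tape_ofE ?nth_nseq; [case: ifP|]; lia.
rewrite /decode_unary foldl_cat foldl_scan_unary foldl_scan_true /=.
by rewrite catrevE cats0 revK.
Qed.

Lemma decode_unary_cat b1 b2 :
  exists s, decode_unary (b1 ++ b2) = decode_unary b1 ++ s.
Proof.
rewrite /decode_unary foldl_cat; move: (foldl _ _ b1) => x.
elim: b2 x => [|b c IH] x /=; first by exists [::]; rewrite cats0.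
have [s ->] := IH (scan x b); case: b; rewrite /scan /=; first by exists s.
by exists (x.1 :: s); rewrite rev_cons -cats1 -catA.
Qed.

(** * Structured programs over counters *)

(** Commands over counters, which a machine keeps on its work tapes, and over its
    input and output tapes.  Counter [i] lives on tape [i.+1]; tape 0 is never
    written, so that testing it for the blank is an unconditional jump. *)
Inductive cmd :=
| Inc of nat
| Dec of nat
| Seq of cmd & cmd
| While of nat & cmd
| If of nat & cmd & cmd
| Next
| WhileIn of cmd
| Out of bool.

Fixpoint compile (o : nat) (c : cmd) : program :=
  match c with
  | Inc i => [:: TapeRight i.+1; TapeWrite i.+1 1]
  | Dec i => [:: TapeLeft i.+1]
  | Seq c d => let u := compile o c in u ++ compile (o + size u) d
  | While i c => let u := compile o.+1 c in
      TapeTest i.+1 0 (o + size u).+2 :: u ++ [:: TapeTest 0 0 o]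
  | If i c d =>
      let u := compile o.+1 c in let l := (o + size u).+2 in
      let v := compile l d in
      TapeTest i.+1 0 l :: u ++ TapeTest 0 0 (l + size v) :: v
  | Next => [:: InNext]
  | WhileIn c => let u := compile o.+2 c in
      [:: InTest o.+2, TapeTest 0 0 (o + size u).+3 & u ++ [:: TapeTest 0 0 o]]
  | Out b => [:: OutWrite b]
  end.

Definition at_code (M : program) (o : nat) (u : program) : Prop :=
  exists pre post, M = pre ++ u ++ post /\ size pre = o.

Lemma at_code_cat M o u v : at_code M o (u ++ v) ->
  at_code M o u /\ at_code M (o + size u) v.
Proof.
move=> [pre [post [-> <-]]]; split.
  by exists pre, (v ++ post); rewrite !catA.
by exists (pre ++ u), post; rewrite size_cat !catA.
Qed.

Lemma at_code_cons M o op u : at_code M o (op :: u) ->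
  onth M o = Some op /\ at_code M o.+1 u.
Proof.
move=> h; have [[pre [post [-> <-]]] h2] := @at_code_cat M o [:: op] u h.
split; last by rewrite addn1 in h2.
by elim: pre {h h2}.
Qed.

(** Counters, position on the input tape, output. *)
Definition state : Type := (nat -> nat) * nat * seq bool.

(** The head stands on the last of [v] ones, with a blank below them.  The cells to
    its right do not matter: a counter grows by moving right and then writing, and
    shrinks by moving left. *)
Definition tape_holds (t : tape) (v : nat) : Prop :=
  exists m, t.1.2 :: t.1.1 = nseq v 1 ++ nseq m.+1 0.

Definition represents (c : config) (st : state) : Prop :=
  [/\ forall i, tape_holds (work c i.+1) (st.1.1 i), tape_read (work c 0) = 0,
      in_pos c = st.1.2 & out c = st.2].

Lemma holds_read t v : tape_holds t v -> (tape_read t == 0) = (v == 0).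
Proof.
by move=> [m]; rewrite /tape_read; case: v => [|v] [-> _].
Qed.

(** Quantifying over all programs that contain the code, at any offset, makes the
    specification of a command independent of where it is placed. *)
Definition runs (inp : nat -> bool) (c : cmd) (st st' : state) : Prop :=
  forall M o cfg, at_code M o (compile o c) -> pc cfg = o -> represents cfg st ->
  exists t, pc (iter t (step M inp) cfg) = o + size (compile o c) /\
            represents (iter t (step M inp) cfg) st'.

Definition upd (s : nat -> nat) (i v : nat) : nat -> nat :=
  fun j => if j == i then v else s j.

Lemma step_at M inp cfg op :
  onth M (pc cfg) = Some op -> step M inp cfg = exec inp op cfg.
Proof. by rewrite /step => ->. Qed.

Lemma runs_inc inp i s k o :
  runs inp (Inc i) (s, k, o) (upd s i (s i).+1, k, o).
Proof.
move=> M l [l' k' w o'] /at_code_cons[e1 /at_code_cons[e2 _]] /= -> [].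
move=> /= hw w0 -> ->.
exists 2; rewrite /= (@step_at _ _ (Config _ _ _ _) _ e1) /=.
rewrite (@step_at _ _ (Config _ _ _ _) _ e2) /=; split; first by rewrite addn2.
split=> //= j; rewrite /upd_tape /upd eqSS; have := hw j.
case: eqVneq => [->|//] [m]; case: (w i.+1) => -[u c] v /= E.
by exists m; rewrite /= E.
Qed.

Lemma runs_dec inp i s k o :
  runs inp (Dec i) (s, k, o) (upd s i (s i).-1, k, o).
Proof.
move=> M l [l' k' w o'] /at_code_cons[e1 _] /= -> [].
move=> /= hw w0 -> ->.
exists 1; rewrite /= (@step_at _ _ (Config _ _ _ _) _ e1) /=; split.
  by rewrite addn1.
split=> //= j; rewrite /upd_tape /upd eqSS; have := hw j.
case: eqVneq => [->|//] [m]; case: (w i.+1) => -[u c] v /= E.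
case: (s i) E => [|n] [_ ->] /=; last by exists m; case: n.
by exists m.-1; case: m.
Qed.

Lemma runs_seq inp c d st1 st2 st3 :
  runs inp c st1 st2 -> runs inp d st2 st3 -> runs inp (Seq c d) st1 st3.
Proof.
move=> h1 h2 M o cfg /at_code_cat[hc hd] epc hr.
have [t1 [p1 r1]] := h1 M o cfg hc epc hr.
have [t2 [p2 r2]] := h2 M _ _ hd p1 r1.
by exists (t2 + t1); rewrite iterD p2 /= size_cat addnA.
Qed.

Lemma runs_next inp s k o : runs inp Next (s, k, o) (s, k.+1, o).
Proof.
move=> M l [l' k' w o'] /at_code_cons[e1 _] /= -> [] /= hw w0 -> ->.
exists 1; rewrite /= (@step_at _ _ (Config _ _ _ _) _ e1) /=; split => //.
by rewrite addn1.
Qed.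

Lemma runs_out inp b s k o : runs inp (Out b) (s, k, o) (s, k, rcons o b).
Proof.
move=> M l [l' k' w o'] /at_code_cons[e1 _] /= -> [] /= hw w0 -> ->.
exists 1; rewrite /= (@step_at _ _ (Config _ _ _ _) _ e1) /=; split => //.
by rewrite addn1.
Qed.

Lemma step_test M inp cfg i l st : represents cfg st ->
  onth M (pc cfg) = Some (TapeTest i.+1 0 l) ->
  exists cfg', [/\ step M inp cfg = cfg', represents cfg' st &
    pc cfg' = if st.1.1 i == 0 then l else (pc cfg).+1].
Proof.
case: cfg => p k w o [/= hw w0 e1 e2] e; rewrite (@step_at _ _ (Config _ _ _ _) _ e).
eexists; split; [by []|by split|] => /=.
by rewrite (holds_read (hw i)).
Qed.

Lemma step_goto M inp cfg l st : represents cfg st ->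
  onth M (pc cfg) = Some (TapeTest 0 0 l) ->
  exists cfg', [/\ step M inp cfg = cfg', represents cfg' st & pc cfg' = l].
Proof.
case: cfg => p k w o [/= hw w0 e1 e2] e; rewrite (@step_at _ _ (Config _ _ _ _) _ e).
by eexists; split; [by []|by split|] => /=; rewrite w0.
Qed.

Lemma runs_while0 inp i c st : st.1.1 i = 0 -> runs inp (While i c) st st.
Proof.
move=> s0 M o cfg /= /at_code_cons[e1 _] epc hr.
rewrite -epc in e1; have [cfg' [e hr' pc']] := step_test inp hr e1.
exists 1; rewrite /= e; split=> //; rewrite pc' s0 eqxx size_cat epc /=.
by rewrite addn1 !addnS.
Qed.

(** One turn of a loop, for loops that never end as well as for those that do. *)
Lemma while_iter inp M o i c cfg st1 st2 :
  at_code M o (compile o (While i c)) -> pc cfg = o -> represents cfg st1 ->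
  st1.1.1 i != 0 -> runs inp c st1 st2 ->
  exists t, pc (iter t (step M inp) cfg) = o /\
            represents (iter t (step M inp) cfg) st2.
Proof.
move=> /= /at_code_cons[e1 /at_code_cat[hc /at_code_cons[e2 _]]] epc hr s0 h1.
rewrite -epc in e1; have [cfg1 [e hr1 pc1]] := step_test inp hr e1.
rewrite (negPf s0) epc in pc1.
have [t2 [p2 r2]] := h1 M _ _ hc pc1 hr1.
rewrite -p2 in e2; have [cfg3 [e3 hr3 pc3]] := step_goto inp r2 e2.
by exists (t2.+1).+1; rewrite iterS iterSr e e3.
Qed.

Lemma runs_whileS inp i c st1 st2 st3 : st1.1.1 i != 0 ->
  runs inp c st1 st2 -> runs inp (While i c) st2 st3 ->
  runs inp (While i c) st1 st3.
Proof.
move=> s0 h1 h2 M o cfg hM epc hr.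
have [t1 [p1 r1]] := while_iter hM epc hr s0 h1.
have [t2 [p2 r2]] := h2 M o _ hM p1 r1.
by exists (t2 + t1); rewrite iterD.
Qed.

Lemma runs_if inp i c d st st' :
  runs inp (if st.1.1 i == 0 then d else c) st st' ->
  runs inp (If i c d) st st'.
Proof.
move=> h M o cfg /= /at_code_cons[e1 /at_code_cat[hc /at_code_cons[e2 hd]]].
move=> epc hr; rewrite -epc in e1.
have [cfg1 [e hr1 pc1]] := step_test inp hr e1.
rewrite epc in pc1; case: ifP h pc1 => _ h pc1.
  rewrite addSn in hd.
  have [t2 [p2 r2]] := h M _ _ hd pc1 hr1.
  exists t2.+1; rewrite iterSr e; split=> //.
  by rewrite p2 size_cat /=; lia.
have [t2 [p2 r2]] := h M _ _ hc pc1 hr1.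
rewrite -p2 in e2; have [cfg3 [e3 hr3 pc3]] := step_goto inp r2 e2.
exists (t2.+1).+1; rewrite iterS iterSr e e3; split=> //.
by rewrite pc3 size_cat /=; lia.
Qed.

Lemma runs_whilein0 inp c st : inp st.1.2 = false -> runs inp (WhileIn c) st st.
Proof.
move=> s0 M o cfg /= /at_code_cons[e1 /at_code_cons[e2 _]] epc hr.
have h1 : step M inp cfg = exec inp (InTest o.+2) cfg.
  by apply: step_at; rewrite epc.
case: cfg epc hr h1 {e1} => p k w out /= -> [/= hw w0 ek eo] h1.
rewrite ek s0 in h1 *.
have [|cfg3 [e3 hr3 pc3]] := @step_goto M inp (Config o.+1 st.1.2 w out) _ st _ e2.
  by split.
exists 2; rewrite /= h1 e3; split=> //; rewrite pc3 size_cat /=; lia.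
Qed.

Lemma runs_whileinS inp c st1 st2 st3 : inp st1.1.2 = true ->
  runs inp c st1 st2 -> runs inp (WhileIn c) st2 st3 ->
  runs inp (WhileIn c) st1 st3.
Proof.
move=> s0 h1 h2 M o cfg /= hM epc hr.
have /at_code_cons[e1 /at_code_cons[_ /at_code_cat[hc /at_code_cons[e2 _]]]] := hM.
have E : step M inp cfg = exec inp (InTest o.+2) cfg by apply: step_at; rewrite epc.
have [cfg1 [e hr1 pc1]] : exists cfg1,
    [/\ step M inp cfg = cfg1, represents cfg1 st1 & pc cfg1 = o.+2].
  rewrite E; case: cfg epc hr {E} => p k w out /= _ [/= hw w0 -> eo].
  by eexists; split; [by []| |]; rewrite s0 //; split.
have [t2 [p2 r2]] := h1 M _ _ hc pc1 hr1.
rewrite -p2 in e2; have [cfg3 [e3 hr3 pc3]] := step_goto inp r2 e2.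
have [t4 [p4 r4]] := h2 M o cfg3 hM pc3 hr3.
by exists (t4 + (t2.+1).+1); rewrite iterD iterS iterSr e e3.
Qed.

Lemma runs_while inp i c (st : nat -> state) n :
  (forall m, m < n -> (st m).1.1 i != 0) -> (st n).1.1 i = 0 ->
  (forall m, m < n -> runs inp c (st m) (st m.+1)) ->
  runs inp (While i c) (st 0) (st n).
Proof.
move=> h1 h2 h3.
suff h m : m <= n -> runs inp (While i c) (st (n - m)) (st n).
  by rewrite -(subnn n); apply: h.
elim: m => [|m IH] lt_m; first by rewrite subn0; apply: runs_while0.
apply: (@runs_whileS _ _ _ _ (st (n - m))); last by apply: IH; apply: ltnW.
- by apply: h1; lia.
- have -> : n - m = (n - m.+1).+1 by lia.
  by apply: h3; lia.
Qed.

(** * Register computable functions *)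

Definition changes (c : cmd) (s s' : nat -> nat) : Prop :=
  forall inp k o, runs inp c (s, k, o) (s', k, o).

Lemma changes_seq c d s1 s2 s3 :
  changes c s1 s2 -> changes d s2 s3 -> changes (Seq c d) s1 s3.
Proof. by move=> h1 h2 inp k o; apply: runs_seq (h1 _ _ _) (h2 _ _ _). Qed.

Lemma changes_if i c d s s' :
  changes (if s i == 0 then d else c) s s' -> changes (If i c d) s s'.
Proof. by move=> h inp k o; apply: runs_if; apply: h. Qed.

Lemma changes_while i c (s : nat -> nat -> nat) n :
  (forall m, m < n -> s m i != 0) -> s n i = 0 ->
  (forall m, m < n -> changes c (s m) (s m.+1)) ->
  changes (While i c) (s 0) (s n).
Proof.
move=> h1 h2 h3 inp k o; apply: (@runs_while _ _ _ (fun m => (s m, k, o))) => //.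
by move=> m /h3; apply.
Qed.

(** Counters [k], [k.+1], ... hold the entries of [l] and then zeros; the counters
    below [k] are those of [s].  With a list as the state, the effect of a command
    on a few counters can be computed. *)
Definition block (s : nat -> nat) (k : nat) (l : seq nat) : nat -> nat :=
  fun j => if j < k then s j else nth 0 l (j - k).

Lemma block_at s k l i : block s k l (k + i) = nth 0 l i.
Proof. by rewrite /block ltnNge leq_addr /= addKn. Qed.

Lemma block_eq s k l l' :
  (forall i, nth 0 l i = nth 0 l' i) -> block s k l = block s k l'.
Proof. by move=> h; apply/funext => j; rewrite /block h. Qed.

Lemma block_pad m s k l : block s k l = block s k (l ++ nseq m 0).
Proof.
apply: block_eq => i; rewrite nth_cat nth_nseq if_same.
by case: ltnP => // h; rewrite nth_default.
Qed.

Lemma block_upd s k l i v : upd (block s k l) (k + i) v = block s k (set_nth 0 l i v).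
Proof.
apply/funext => j; rewrite /upd /block nth_set_nth /=.
case: ltnP => [lt_j|le_j]; first by case: eqP => // ?; lia.
by rewrite -{1}(subnKC le_j) eqn_add2l.
Qed.

Lemma block_cons s k a l : block s k (a :: l) = block (upd s k a) k.+1 l.
Proof.
apply/funext => j; rewrite /block /upd ltnS.
case: (ltngtP j k) => [//|lt_kj|->]; last by rewrite subnn.
by have -> : j - k = (j - k.+1).+1 by lia.
Qed.

Section straight_line.
Variables (s : nat -> nat) (k : nat).
Implicit Types l : seq nat.

Lemma changes_inc i l :
  changes (Inc (k + i)) (block s k l) (block s k (set_nth 0 l i (nth 0 l i).+1)).
Proof. by move=> inp p o; rewrite -block_upd -(block_at s k); apply: runs_inc. Qed.

Lemma changes_dec i l :
  changes (Dec (k + i)) (block s k l) (block s k (set_nth 0 l i (nth 0 l i).-1)).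
Proof. by move=> inp p o; rewrite -block_upd -(block_at s k); apply: runs_dec. Qed.

Lemma changes_loop i c (L : nat -> seq nat) n :
  (forall m, m < n -> nth 0 (L m) i != 0) -> nth 0 (L n) i = 0 ->
  (forall m, m < n -> changes c (block s k (L m)) (block s k (L m.+1))) ->
  changes (While (k + i) c) (block s k (L 0)) (block s k (L n)).
Proof.
move=> h1 h2 h3; apply: (@changes_while _ _ (fun m => block s k (L m))) => //.
- by move=> m lt_m; rewrite block_at h1.
- by rewrite block_at.
Qed.

Definition move_cmd i j := While (k + i) (Seq (Dec (k + i)) (Inc (k + j))).

Lemma changes_move i j l : i != j ->
  changes (move_cmd i j) (block s k l)
    (block s k (set_nth 0 (set_nth 0 l i 0) j (nth 0 l j + nth 0 l i))).
Proof.
move=> nij.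
pose L m := set_nth 0 (set_nth 0 l i (nth 0 l i - m)) j (nth 0 l j + m).
have <- : block s k (L 0) = block s k l.
  apply: block_eq => x; rewrite /L subn0 addn0 !nth_set_nth /= !nth_set_nth /=.
  by case: eqP => [->|_] //; case: eqP => [->|_].
have -> : set_nth 0 (set_nth 0 l i 0) j (nth 0 l j + nth 0 l i) = L (nth 0 l i).
  by rewrite /L subnn.
have Li m : nth 0 (L m) i = nth 0 l i - m.
  by rewrite /L !nth_set_nth /= (negPf nij) nth_set_nth /= eqxx.
have Lj m : nth 0 (L m) j = nth 0 l j + m by rewrite nth_set_nth /= eqxx.
apply: changes_loop => [m lt_m||m lt_m]; rewrite ?Li ?subnn ?subn_eq0 -?ltnNge //.
apply: changes_seq (@changes_dec _ _) _.
set l1 := set_nth 0 (L m) i _.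
have l1j : nth 0 l1 j = nth 0 l j + m.
  by rewrite /l1 nth_set_nth /= eq_sym (negPf nij).
have -> : block s k (L m.+1) = block s k (set_nth 0 l1 j (nth 0 l1 j).+1).
  apply: block_eq => x; rewrite l1j !nth_set_nth /=.
  case: (eqVneq x j) => [_|nxj]; first by rewrite addnS.
  rewrite /l1 Li !nth_set_nth /=; case: (eqVneq x i) => [_|nxi].
    by rewrite subnS.
  by rewrite /L nth_set_nth /= (negPf nxj) nth_set_nth /= (negPf nxi).
exact: changes_inc.
Qed.

Lemma changes_to c s0 l l' : changes c s0 (block s k l) -> l = l' ->
  changes c s0 (block s k l').
Proof. by move=> h <-. Qed.

Definition double_cmd i j :=
  While (k + i) (Seq (Dec (k + i)) (Seq (Inc (k + j)) (Inc (k + j)))).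

Lemma changes_double12 a b :
  changes (double_cmd 1 2) (block s k [:: a; b; 0]) (block s k [:: a; 0; b.*2]).
Proof.
have := @changes_loop 1 (Seq (Dec (k + 1)) (Seq (Inc (k + 2)) (Inc (k + 2))))
  (fun m => [:: a; b - m; m.*2]) b.
rewrite subn0 subnn double0; apply => //= m lt_m; first by rewrite -lt0n subn_gt0.
apply: changes_seq (@changes_dec 1 _) _; apply: changes_seq (@changes_inc 2 _) _.
by apply: changes_to (@changes_inc 2 _) _; rewrite /= subnS.
Qed.

Lemma changes_double21 a b :
  changes (double_cmd 2 1) (block s k [:: a; 0; b]) (block s k [:: a; b.*2; 0]).
Proof.
have := @changes_loop 2 (Seq (Dec (k + 2)) (Seq (Inc (k + 1)) (Inc (k + 1))))
  (fun m => [:: a; m.*2; b - m]) b.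
rewrite subn0 subnn double0; apply => //= m lt_m; first by rewrite -lt0n subn_gt0.
apply: changes_seq (@changes_dec 2 _) _; apply: changes_seq (@changes_inc 1 _) _.
by apply: changes_to (@changes_inc 1 _) _; rewrite /= subnS.
Qed.

Definition pair_cmd :=
  Seq (double_cmd 1 2) (Seq (Inc (k + 2)) (Seq
    (While (k + 0) (Seq (Dec (k + 0)) (Seq (double_cmd 2 1) (move_cmd 1 2))))
    (Seq (Dec (k + 2)) (move_cmd 2 0)))).

Lemma changes_pair a b :
  changes pair_cmd (block s k [:: a; b]) (block s k [:: npair a b]).
Proof.
rewrite (block_pad 1) (@block_pad 2 _ _ [:: npair a b]).
apply: changes_seq (@changes_double12 _ _) _.
apply: changes_seq (@changes_inc 2 _) _ => /=.
apply: (@changes_seq _ _ _ (block s k [:: 0; 0; 2 ^ a * b.*2.+1])).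
  have := @changes_loop 0 (Seq (Dec (k + 0)) (Seq (double_cmd 2 1) (move_cmd 1 2)))
    (fun m => [:: a - m; 0; 2 ^ m * b.*2.+1]) a.
  rewrite subn0 subnn mul1n; apply => //= m lt_m.
    by rewrite -lt0n subn_gt0.
  apply: changes_seq (@changes_dec 0 _) _ => /=.
  apply: changes_seq (@changes_double21 _ _) _.
  apply: changes_to (@changes_move 1 2 _ _) _ => //=.
  by rewrite subnS add0n -mul2n mulnA expnS.
apply: changes_seq (@changes_dec 2 _) _ => /=.
exact: changes_to (@changes_move 2 0 _ _) _.
Qed.

(** Halves counter [k] into [k.+1], with the remainder in [k.+2]. *)
Definition half_cmd :=
  While (k + 0) (Seq (Dec (k + 0))
    (If (k + 0) (Seq (Dec (k + 0)) (Inc (k + 1))) (Inc (k + 2)))).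

Lemma changes_half a c d : changes half_cmd (block s k [:: a; 0; 0; c; d])
  (block s k [:: 0; a./2; odd a : nat; c; d]).
Proof.
(* the state after m turns; the last turn may find a single unit left *)
pose L m := [:: a - m.*2; minn m a./2; (odd a && (a./2 < m)) : nat; c; d].
have -> : [:: a; 0; 0; c; d] = L 0 by rewrite /L subn0 min0n andbF.
have -> : [:: 0; a./2; odd a : nat; c; d] = L (uphalf a).
  rewrite /L uphalf_half; case: (odd a) (odd_double_half a) => /= E.
    by congr [:: _, _, _ & _]; lia.
  by congr [:: _, _, _ & _]; lia.
apply: changes_loop => [m lt_m||m lt_m] /=; [lia|lia|].
apply: changes_seq (@changes_dec 0 _) _ => /=.
apply: changes_if; rewrite block_at /=.
have E := odd_double_half a; case: ifP => h.
  apply: changes_to (@changes_inc 2 _) _ => /=; rewrite /L.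
  by congr [:: _, _, _ & _]; case: (odd a) E h lt_m => /=; lia.
apply: changes_seq (@changes_dec 0 _) _ => /=.
apply: changes_to (@changes_inc 1 _) _ => /=; rewrite /L.
by congr [:: _, _, _ & _]; case: (odd a) E h lt_m => /=; lia.
Qed.

(** Halves [n.+1 = 2 ^ a * b.*2.+1] until a remainder appears: then the half is [b]
    and the number of halvings before is [a].  Counter [k.+3] keeps the loop going,
    [k.+4] counts the halvings. *)
Definition unpair_cmd :=
  Seq (Inc (k + 0)) (Seq (Inc (k + 3)) (Seq
    (While (k + 3) (Seq (Dec (k + 3)) (Seq half_cmd
       (If (k + 2) (Dec (k + 2))
          (Seq (move_cmd 1 0) (Seq (Inc (k + 4)) (Inc (k + 3))))))))
  (move_cmd 4 0))).

Lemma changes_unpair a b :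
  changes unpair_cmd (block s k [:: npair a b]) (block s k [:: a; b]).
Proof.
rewrite (block_pad 4) (@block_pad 3 _ _ [:: a; b]).
apply: changes_seq (@changes_inc 0 _) _ => /=.
apply: changes_seq (@changes_inc 3 _) _ => /=.
apply: (@changes_seq _ _ _ (block s k [:: 0; b; 0; 0; a])); last first.
  exact: changes_to (@changes_move 4 0 _ _) _.
pose L m := if m <= a then [:: 2 ^ (a - m) * b.*2.+1; 0; 0; 1; m]
            else [:: 0; b; 0; 0; a].
have -> : [:: (npair a b).+1; 0; 0; 1; 0] = L 0.
  by rewrite /L subn0 /npair prednK // muln_gt0 expn_gt0.
have -> : [:: 0; b; 0; 0; a] = L a.+1 by rewrite /L ltnn.
apply: changes_loop => [m||m] /=; rewrite /L; [by rewrite ltnS => ->|by rewrite ltnn|].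
rewrite ltnS => le_m; rewrite le_m.
apply: changes_seq (@changes_dec 3 _) _ => /=.
apply: changes_seq (@changes_half _ _ _) _.
apply: changes_if; rewrite block_at /=.
move: le_m; rewrite leq_eqVlt => /predU1P[->|lt_m].
  rewrite ltnn subnn mul1n /= odd_double /=.
  by apply: changes_to (@changes_dec 2 _) _; rewrite /= uphalf_double.
have -> : 2 ^ (a - m) * b.*2.+1 = (2 ^ (a - m.+1) * b.*2.+1).*2.
  by rewrite -[RHS]mul2n mulnA -expnS subnSK.
rewrite odd_double doubleK /= lt_m.
apply: changes_seq (@changes_move 1 0 _ _) _ => //=.
apply: changes_seq (@changes_inc 4 _) _ => /=.
by apply: changes_to (@changes_inc 3 _) _.
Qed.

End straight_line.

(** The command works in place on counter [k] and leaves those above it zero, so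
    that other values can be kept below [k] during a computation. *)
Definition regcomp (f : nat -> nat) : Prop :=
  forall k, exists c, forall s n, changes c (block s k [:: n]) (block s k [:: f n]).

Lemma regcomp_eq f g : f =1 g -> regcomp f -> regcomp g.
Proof. by move=> /funext ->. Qed.

Lemma regcomp_comp f g : regcomp f -> regcomp g -> regcomp (fun n => f (g n)).
Proof.
move=> hf hg k; have [c hc] := hg k; have [d hd] := hf k.
by exists (Seq c d) => s n; apply: changes_seq (hc _ _) (hd _ _).
Qed.

Lemma regcomp_succ : regcomp succn.
Proof. by move=> k; exists (Inc (k + 0)) => s n;
  apply: changes_to (@changes_inc _ _ 0 _) _. Qed.

Lemma regcomp_id : regcomp id.
Proof.
move=> k; exists (Seq (Inc (k + 0)) (Dec (k + 0))) => s n.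
apply: changes_seq (@changes_inc _ _ 0 _) _.
by apply: changes_to (@changes_dec _ _ 0 _) _.
Qed.

Lemma changes_clear i s k l :
  changes (While (k + i) (Dec (k + i))) (block s k l) (block s k (set_nth 0 l i 0)).
Proof.
have -> : block s k l = block s k (set_nth 0 l i (nth 0 l i)).
  by apply: block_eq => x; rewrite nth_set_nth /=; case: eqP => [->|].
have := @changes_loop s k i (Dec (k + i))
  (fun m => set_nth 0 l i (nth 0 l i - m)) (nth 0 l i).
rewrite subn0 subnn; apply => [m lt_m||m lt_m];
  rewrite ?nth_set_nth /= ?eqxx ?subn_eq0 -?ltnNge //.
apply: changes_to (@changes_dec _ _ i _) _.
by rewrite nth_set_nth /= eqxx set_set_nth eqxx subnS.
Qed.

Lemma regcomp_zero : regcomp (fun=> 0).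
Proof.
move=> k; exists (While (k + 0) (Dec (k + 0))) => s n.
exact: changes_to (@changes_clear 0 _ _ _) _.
Qed.

Lemma regcomp_left : regcomp (fun n => (nunpair n).1).
Proof.
move=> k; exists (Seq (unpair_cmd k) (While (k + 1) (Dec (k + 1)))) => s n.
rewrite -{1}(nunpairK n); apply: changes_seq (@changes_unpair _ _ _ _) _.
by rewrite (@block_pad 1 _ _ [:: _]); apply: changes_to (@changes_clear 1 _ _ _) _.
Qed.

Lemma regcomp_right : regcomp (fun n => (nunpair n).2).
Proof.
move=> k.
exists (Seq (unpair_cmd k) (Seq (While (k + 0) (Dec (k + 0))) (move_cmd k 1 0))) => s n.
rewrite -{1}(nunpairK n); apply: changes_seq (@changes_unpair _ _ _ _) _.
apply: changes_seq (@changes_clear 0 _ _ _) _ => /=.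
by rewrite (@block_pad 1 _ _ [:: _]); apply: changes_to (@changes_move _ _ 1 0 _ _) _.
Qed.

Definition swap_cmd k :=
  Seq (move_cmd k 0 2) (Seq (move_cmd k 1 0) (move_cmd k 2 1)).

Lemma changes_swap s k a b :
  changes (swap_cmd k) (block s k [:: a; b]) (block s k [:: b; a]).
Proof.
rewrite (block_pad 1) (@block_pad 1 _ _ [:: b; a]).
apply: changes_seq (@changes_move _ _ 0 2 _ _) _ => //=.
apply: changes_seq (@changes_move _ _ 1 0 _ _) _ => //=.
exact: changes_to (@changes_move _ _ 2 1 _ _) _.
Qed.

Definition copy_cmd k :=
  Seq (While (k + 0) (Seq (Dec (k + 0)) (Seq (Inc (k + 1)) (Inc (k + 2)))))
      (move_cmd k 2 0).

Lemma changes_copy s k a :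
  changes (copy_cmd k) (block s k [:: a]) (block s k [:: a; a]).
Proof.
rewrite (block_pad 2) (@block_pad 1 _ _ [:: a; a]).
apply: (@changes_seq _ _ _ (block s k [:: 0; a; a])); last first.
  exact: changes_to (@changes_move _ _ 2 0 _ _) _.
have := @changes_loop s k 0 (Seq (Dec (k + 0)) (Seq (Inc (k + 1)) (Inc (k + 2))))
  (fun m => [:: a - m; m; m]) a.
rewrite subn0 subnn; apply => //= m lt_m; first by rewrite -lt0n subn_gt0.
apply: changes_seq (@changes_dec _ _ 0 _) _;
  apply: changes_seq (@changes_inc _ _ 1 _) _.
by apply: changes_to (@changes_inc _ _ 2 _) _; rewrite /= subnS.
Qed.

Lemma regcomp_pair f g : regcomp f -> regcomp g ->
  regcomp (fun n => npair (f n) (g n)).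
Proof.
move=> hf hg k; have [c hc] := hf k.+1; have [d hd] := hg k.+1.
exists (Seq (copy_cmd k) (Seq c (Seq (swap_cmd k) (Seq d (pair_cmd k))))) => s n.
apply: changes_seq (@changes_copy _ _ _) _.
apply: (@changes_seq _ _ _ (block s k [:: n; f n])).
  by rewrite !(block_cons s k n); apply: hc.
apply: changes_seq (@changes_swap _ _ _ _) _.
apply: (@changes_seq _ _ _ (block s k [:: f n; g n])).
  by rewrite !(block_cons s k (f n)); apply: hd.
exact: changes_pair.
Qed.

(** The counter of the loop is kept below the iterated value. *)
Lemma regcomp_iter f : regcomp f ->
  regcomp (fun n => iter (nunpair n).2 f (nunpair n).1).
Proof.
move=> hf k; have [c hc] := hf k.+1.
exists (Seq (unpair_cmd k) (Seq (swap_cmd k)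
  (Seq (While (k + 0) (Seq (Dec (k + 0)) c)) (move_cmd k 1 0)))) => s n.
rewrite -{1}(nunpairK n); move: (nunpair n) => [a m] /=.
apply: changes_seq (@changes_unpair _ _ _ _) _.
apply: changes_seq (@changes_swap _ _ _ _) _.
apply: (@changes_seq _ _ _ (block s k [:: 0; iter m f a])).
  have := @changes_loop s k 0 (Seq (Dec (k + 0)) c) (fun i => [:: m - i; iter i f a]) m.
  rewrite subn0 subnn; apply => //= i lt_i; first by rewrite -lt0n subn_gt0.
  apply: changes_seq (@changes_dec _ _ 0 _) _ => /=.
  by rewrite -subnS !(block_cons s k (m - i.+1)); apply: hc.
rewrite (@block_pad 1 _ _ [:: iter _ _ _]).
exact: changes_to (@changes_move _ _ 1 0 _ _) _.
Qed.

(** * Machines that write a sequence *)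

Lemma machine_surj (M : program) : exists n, machine n = M.
Proof.
have instr_surj op : exists c, instr_of c = op.
  suff [l hl] : exists l, (fun l => instr_of (CodeSeq.code l)) l = op.
    by exists (CodeSeq.code l).
  rewrite /instr_of; case: op => [i|i|i s|i s l||l|b].
  - by exists [:: 0; i]; rewrite CodeSeq.codeK.
  - by exists [:: 1; i]; rewrite CodeSeq.codeK.
  - by exists [:: 2; i; s]; rewrite CodeSeq.codeK.
  - by exists [:: 3; i; s; l]; rewrite CodeSeq.codeK.
  - by exists [::]; rewrite CodeSeq.codeK.
  - by exists [:: 4; l]; rewrite CodeSeq.codeK.
  - by exists [:: 5; b : nat]; rewrite CodeSeq.codeK; case: b.
suff [l <-] : exists l, map instr_of l = M.
  by exists (CodeSeq.code l); rewrite /machine CodeSeq.codeK.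
elim: M => [|op M [l <-]]; first by exists [::].
by have [c <-] := instr_surj op; exists (c :: l).
Qed.

Lemma at_code_seq M o c d : at_code M o (compile o (Seq c d)) ->
  at_code M o (compile o c) /\
  at_code M (o + size (compile o c)) (compile (o + size (compile o c)) d).
Proof. exact: at_code_cat. Qed.

Lemma at_code_self u : at_code u 0 u.
Proof. by exists [::], [::]; rewrite cats0. Qed.

Lemma code_cons n s : CodeSeq.code (n :: s) = (npair n (CodeSeq.code s)).+1.
Proof. by rewrite /npair prednK ?muln_gt0 ?expn_gt0. Qed.

Section stream.
Variable g : nat -> nat.

(** The prefix is coded in reverse, so that reading one more entry is one [cons]. *)
Definition stream (p : baire) : baire :=
  fun k => g (CodeSeq.code (rev (mkseq p k.+1))).

(** Counter 0 is never changed and keeps the main loop going; counter 1 holds the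
    code of the entries read so far. *)
Definition stream_state (p : baire) (k : nat) : state :=
  (block (fun=> 0) 0 [:: 1; CodeSeq.code (rev (mkseq p k))], entry_pos p k,
   unary (mkseq (stream p) k)).

Lemma runs_read p k s l : nth 0 l 2 = 0 ->
  forall o, runs (tape_of p) (WhileIn (Seq Next (Inc (0 + 2))))
    (block s 0 l, entry_pos p k, o) (block s 0 (set_nth 0 l 2 (p k)), entry_pos p k +
      p k, o).
Proof.
move=> l2 o.
suff h m : m <= p k -> runs (tape_of p) (WhileIn (Seq Next (Inc (0 + 2))))
    (block s 0 (set_nth 0 l 2 (p k - m)), entry_pos p k + (p k - m), o)
    (block s 0 (set_nth 0 l 2 (p k)), entry_pos p k + p k, o).
  have := h (p k) (leqnn _); rewrite subnn addn0.
  congr runs; congr (_, _, _); apply: block_eq => i.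
  by rewrite nth_set_nth /=; case: eqP => // ->.
elim: m => [|m IH] le_m.
  by rewrite subn0; apply: runs_whilein0; rewrite /= tape_ofE // eqxx.
apply: runs_whileinS (IH (ltnW le_m)); rewrite /=.
  by rewrite tape_ofE; lia.
apply: runs_seq (@runs_next _ _ _ _) _.
have := @changes_inc s 0 2 (set_nth 0 l 2 (p k - m.+1)) (tape_of p)
  (entry_pos p k + (p k - m.+1)).+1 o.
rewrite nth_set_nth /= set_set_nth eqxx.
by rewrite -addnS; have -> : (p k - m.+1).+1 = p k - m by lia.
Qed.

Lemma runs_write inp s v a b p o :
  runs inp (While (0 + 2) (Seq (Dec (0 + 2)) (Out true)))
    (block s 0 [:: a; b; v], p, o) (block s 0 [:: a; b; 0], p, o ++ nseq v true).
Proof.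
have := @runs_while inp (0 + 2) (Seq (Dec (0 + 2)) (Out true))
  (fun m => (block s 0 [:: a; b; v - m], p, o ++ nseq m true)) v.
rewrite subn0 subnn cats0; apply => [m lt_m||m lt_m] //=.
  by rewrite block_at /= -lt0n subn_gt0.
apply: runs_seq (@changes_dec _ _ 2 _ _ _ _) _ => /=.
have := @runs_out inp true (block s 0 [:: a; b; (v - m).-1]) p (o ++ nseq m true).
by rewrite -cats1 -catA -(nseqD m 1 true) addn1 subnS.
Qed.

Definition stream_body (c : cmd) : cmd :=
  Seq (WhileIn (Seq Next (Inc (0 + 2)))) (Seq Next
  (Seq (swap_cmd 1)
  (Seq (pair_cmd 1) (Seq (Inc (0 + 1)) (Seq (copy_cmd 1) (Seq c
  (Seq (While (0 + 2) (Seq (Dec (0 + 2)) (Out true))) (Out false)))))))).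

Lemma runs_body c p k :
  (forall s n, changes c (block s 2 [:: n]) (block s 2 [:: g n])) ->
  runs (tape_of p) (stream_body c) (stream_state p k) (stream_state p k.+1).
Proof.
move=> hc; rewrite /stream_state; set L := CodeSeq.code (rev (mkseq p k)).
have -> : CodeSeq.code (rev (mkseq p k.+1)) = (npair (p k) L).+1.
  by rewrite mkseqS rev_rcons code_cons.
set s0 := fun=> 0; set M := (npair (p k) L).+1.
apply: runs_seq (@runs_read _ _ _ _ _ _) _ => //=.
apply: runs_seq (@runs_next _ _ _ _) _; rewrite -addnS -entry_posS.
have block1 l : block s0 0 (1 :: l) = block (upd s0 0 1) 1 l by rewrite block_cons.
apply: (@runs_seq _ _ _ _ (block s0 0 [:: 1; p k; L], _, _)).
  by rewrite !block1; apply: changes_swap.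
apply: (@runs_seq _ _ _ _ (block s0 0 [:: 1; npair (p k) L], _, _)).
  by rewrite !block1; apply: changes_pair.
apply: runs_seq (@changes_inc _ _ 1 _ _ _ _) _; rewrite /= -/M.
apply: (@runs_seq _ _ _ _ (block s0 0 [:: 1; M; M], _, _)).
  by rewrite !block1; apply: changes_copy.
apply: (@runs_seq _ _ _ _ (block s0 0 [:: 1; M; g M], entry_pos p k.+1,
  unary (mkseq (stream p) k))).
  by rewrite !(block_cons _ _ 1) !(block_cons _ 1 M); apply: hc.
apply: runs_seq (@runs_write _ _ _ _ _ _ _) _.
have := @runs_out (tape_of p) false (block s0 0 [:: 1; M; 0]) (entry_pos p k.+1)
  (unary (mkseq (stream p) k) ++ nseq (g M) true).
congr runs; congr (_, _, _); last first.
  rewrite mkseqS unary_rcons rcons_cat; congr (_ ++ rcons (nseq _ _) _).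
  by rewrite /stream mkseqS rev_rcons code_cons.
by apply: block_eq => -[|[|[|[]]]].
Qed.

Theorem stream_computable :
  regcomp g -> exists n, forall p, Phi n p (stream p).
Proof.
move=> hg; have [c hc] := hg 2.
pose M := compile 0 (Seq (Inc 0) (While 0 (stream_body c))).
have [n hn] := machine_surj M; exists n => p k; rewrite hn.
have hM : at_code M 0 (compile 0 (Seq (Inc 0) (While 0 (stream_body c)))).
  exact: at_code_self.
have {hM}[h1 h2] := at_code_seq hM.
set l := 0 + _ in h2.
suff [t [_ [_ _ _ e]]] : exists t, pc (run M (tape_of p) t) = l /\
    represents (run M (tape_of p) t) (stream_state p k.+1).
  exists t; rewrite /= e; have lt_k := entry_pos_ge (stream p) k.+1.
  by split; [exact: lt_k | rewrite nth_unary].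
elim: (k.+1) => [|j [t [e r]]]; last first.
  have hz : (stream_state p j).1.1 0 != 0 by [].
  have [t' [e' r']] := while_iter h2 e r hz (@runs_body _ _ _ hc).
  by exists (t' + t); rewrite /run iterD.
have r0 : represents init_config (block (fun=> 0) 0 [:: 0], 0, [::]).
  by split => //= -[|i]; exists 0; rewrite // /block subn0 nth_default.
have [t [e r]] := @changes_inc (fun=> 0) 0 0 [:: 0] (tape_of p) _ _ M 0 _ h1
  (erefl : pc init_config = 0) r0.
exists t; split=> //; move: r; congr represents; rewrite /stream_state /=.
by congr (_, _, _); apply: block_eq => -[|[|[]]].
Qed.

End stream.

(** * Functions computable on codes *)

Arguments nunpair : simpl never.
Arguments npair : simpl never.

Class Coded (A : Type) := ecode : A -> nat.

#[export] Instance Coded_nat : Coded nat := id.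
#[export] Instance Coded_bool : Coded bool := nat_of_bool.
#[export] Instance Coded_prod A B (cA : Coded A) (cB : Coded B) : Coded (A * B) :=
  fun x => npair (ecode x.1) (ecode x.2).
#[export] Instance Coded_seq A (cA : Coded A) : Coded (seq A) :=
  fun s => CodeSeq.code (map ecode s).

(** Nothing is asked on numbers that code no argument.  The codes of lists of numbers
    are those of [CodeSeq], so that the identity computes [CodeSeq.decode]. *)
Definition codecomp A B {cA : Coded A} {cB : Coded B} (f : A -> B) : Prop :=
  exists2 g, regcomp g & forall a, g (ecode a) = ecode (f a).

Section basic.
Context {X A B C : Type} {cX : Coded X} {cA : Coded A} {cB : Coded B} {cC : Coded C}.

Lemma regcomp_const n : regcomp (fun=> n).
Proof.
elim: n => [|n IH]; first exact: regcomp_zero.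
exact: regcomp_comp regcomp_succ IH.
Qed.

Lemma codecomp_id : codecomp (fun x : X => x).
Proof. by exists id => //; apply: regcomp_id. Qed.

Lemma codecomp_const (a : A) : codecomp (fun _ : X => a).
Proof. by exists (fun=> ecode a) => //; apply: regcomp_const. Qed.

Lemma codecomp_comp (g : A -> B) (f : X -> A) :
  codecomp g -> codecomp f -> codecomp (fun x => g (f x)).
Proof.
move=> [g' hg eg] [f' hf ef]; exists (fun n => g' (f' n)).
  exact: regcomp_comp.
by move=> x; rewrite ef eg.
Qed.

Lemma codecomp_pair (f : X -> A) (g : X -> B) :
  codecomp f -> codecomp g -> codecomp (fun x => (f x, g x)).
Proof.
move=> [f' hf ef] [g' hg eg]; exists (fun n => npair (f' n) (g' n)).
  exact: regcomp_pair.
by move=> x; rewrite ef eg.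
Qed.

End basic.

Section products.
Context {X A B C : Type} {cX : Coded X} {cA : Coded A} {cB : Coded B} {cC : Coded C}.

Lemma codecomp_fst (f : X -> A * B) : codecomp f -> codecomp (fun x => (f x).1).
Proof.
apply: codecomp_comp; exists (fun n => (nunpair n).1); first exact: regcomp_left.
by move=> [a b]; rewrite npairK.
Qed.

Lemma codecomp_snd (f : X -> A * B) : codecomp f -> codecomp (fun x => (f x).2).
Proof.
apply: codecomp_comp; exists (fun n => (nunpair n).2); first exact: regcomp_right.
by move=> [a b]; rewrite npairK.
Qed.

Lemma codecomp_app2 (h : A -> B -> C) (f : X -> A) (g : X -> B) :
  codecomp (fun y : A * B => h y.1 y.2) -> codecomp f -> codecomp g ->
  codecomp (fun x => h (f x) (g x)).
Proof.
by move=> hh hf hg; apply: (@codecomp_comp _ _ _ _ _ _ _ (fun x =>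
  (f x, g x)) hh (codecomp_pair hf hg)).
Qed.

End products.
Arguments codecomp_app2 {X A B C cX cA cB cC h f g}.

Section more.
Context {X A B C D : Type} {cX : Coded X} {cA : Coded A} {cB : Coded B} {cC :
  Coded C} {cD : Coded D}.

Lemma codecomp_app3 (h : A -> B -> C -> D) (f : X -> A) (g : X -> B) (k : X -> C) :
  codecomp (fun y : A * B * C => h y.1.1 y.1.2 y.2) -> codecomp f -> codecomp g ->
    codecomp k ->
  codecomp (fun x => h (f x) (g x) (k x)).
Proof.
move=> hh hf hg hk.
exact: (@codecomp_comp _ _ _ _ _ _ _ (fun x =>
  (f x, g x, k x)) hh (codecomp_pair (codecomp_pair hf hg) hk)).
Qed.

Lemma codecomp_succ (f : X -> nat) : codecomp f -> codecomp (fun x => (f x).+1).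
Proof. by apply: codecomp_comp; exists succn => //; apply: regcomp_succ. Qed.

(** The argument [x] has to be carried along, so pairs of [x] and the iterated value
    are iterated. *)
Lemma codecomp_iter (n : X -> nat) (h : X -> A -> A) (i : X -> A) :
  codecomp n -> codecomp (fun y : X * A => h y.1 y.2) -> codecomp i ->
  codecomp (fun x => iter (n x) (h x) (i x)).
Proof.
move=> [n' hn en] [h' hh eh] [i' hi ei].
pose st c := npair (nunpair c).1 (h' c).
have hst : regcomp st by apply: regcomp_pair => //; apply: regcomp_left.
exists (fun c => (nunpair (iter (nunpair (npair (npair c (i' c)) (n' c))).2 st
     (nunpair (npair (npair c (i' c)) (n' c))).1)).2).
  apply: regcomp_comp regcomp_right _.
  apply: (@regcomp_comp (fun c => iter (nunpair c).2 st (nunpair c).1)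
     (fun c => npair (npair c (i' c)) (n' c))); first exact: regcomp_iter.
  by do 2![apply: regcomp_pair => //]; apply: regcomp_id.
move=> x; have E m : iter m st (npair (ecode x) (ecode (i x)))
           = npair (ecode x) (ecode (iter m (h x) (i x))).
  elim: m => //= m ->; rewrite /st npairK /=; congr npair.
  exact: (eh (x, iter m (h x) (i x))).
by cbv beta; rewrite npairK [(_, _).1]/= [(_, _).2]/= en ei E npairK.
Qed.

(** A choice is an iteration that takes place once or not at all. *)
Lemma codecomp_if (b : X -> bool) (f g : X -> A) :
  codecomp b -> codecomp f -> codecomp g -> codecomp (fun x =>
    if b x then f x else g x).
Proof.
move=> hb hf hg.
have -> : (fun x => if b x then f x else g x)
   = (fun x => iter (b x) (fun=> f x) (g x)) by apply/funext => x; case: (b x).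
apply: (@codecomp_iter (fun x => nat_of_bool (b x)) (fun x _ => f x)) => //.
exact: codecomp_comp hf (codecomp_fst codecomp_id).
Qed.

End more.

(* The hints follow the syntax of the function; constants are opaque so that they
   are not unfolded in search of a match. *)
Create HintDb codecomp discriminated.
#[export] Hint Constants Opaque : codecomp.
#[export] Hint Resolve codecomp_id codecomp_const codecomp_pair codecomp_fst
  codecomp_snd codecomp_succ
  codecomp_iter codecomp_if : codecomp.

(* the bound of eauto limits the length of the whole proof, not its depth *)
Ltac solve_codecomp := solve [eauto 3000 with codecomp].

Lemma codecomp_pred {X} {cX : Coded X} (f : X -> nat) :
  codecomp f -> codecomp (fun x => (f x).-1).
Proof.
move=> hf; have -> : (fun x => (f x).-1) =
    (fun x => (iter (f x) (fun y => (y.2, y.2.+1)) (0, 0)).1).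
  apply/funext => x; suff -> n : iter n (fun y =>
    (y.2, y.2.+1)) (0, 0) = (n.-1, n) by [].
  by elim: n => //= n ->.
solve_codecomp.
Qed.
#[export] Hint Resolve codecomp_pred : codecomp.

Lemma codecomp_add {X} {cX : Coded X} (f g : X -> nat) :
  codecomp f -> codecomp g -> codecomp (fun x => f x + g x).
Proof.
move=> hf hg; have -> : (fun x => f x + g x) = (fun x => iter (f x) succn (g x)).
  by apply/funext => x; rewrite iter_succn addnC.
exact: (@codecomp_iter _ _ _ _ f (fun=> succn) g hf (codecomp_succ (codecomp_snd
  codecomp_id)) hg).
Qed.
#[export] Hint Resolve codecomp_add : codecomp.

Lemma codecomp_sub {X} {cX : Coded X} (f g : X -> nat) :
  codecomp f -> codecomp g -> codecomp (fun x => f x - g x).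
Proof.
move=> hf hg; have -> : (fun x => f x - g x) = (fun x => iter (g x) (fun n =>
  n.-1) (f x)).
  by apply/funext => x; rewrite iter_predn.
solve_codecomp.
Qed.
#[export] Hint Resolve codecomp_sub : codecomp.

Lemma codecomp_mul {X} {cX : Coded X} (f g : X -> nat) :
  codecomp f -> codecomp g -> codecomp (fun x => f x * g x).
Proof.
move=> hf hg.
have -> : (fun x => f x * g x) = (fun x => iter (f x) (fun n => g x + n) 0).
  by apply/funext => x; rewrite iter_addn_0 mulnC.
have hg1 : codecomp (fun y : X * nat => g y.1) by apply: codecomp_comp hg _;
  solve_codecomp.
solve_codecomp.
Qed.
#[export] Hint Resolve codecomp_mul : codecomp.

Lemma codecomp_exp {X} {cX : Coded X} (f g : X -> nat) :
  codecomp f -> codecomp g -> codecomp (fun x => f x ^ g x).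
Proof.
move=> hf hg.
have -> : (fun x => f x ^ g x) = (fun x => iter (g x) (fun n => f x * n) 1).
  by apply/funext => x; rewrite iter_muln_1.
have hf1 : codecomp (fun y : X * nat => f y.1) by apply: codecomp_comp hf _;
  solve_codecomp.
solve_codecomp.
Qed.
#[export] Hint Resolve codecomp_exp : codecomp.

Lemma codecomp_eq0 {X} {cX : Coded X} (f : X -> nat) :
  codecomp f -> codecomp (fun x => f x == 0).
Proof.
move=> hf; have -> : (fun x => f x == 0) = (fun x => iter (f x) (fun=> false) true).
  by apply/funext => x; case: (f x).
solve_codecomp.
Qed.
#[export] Hint Resolve codecomp_eq0 : codecomp.

Lemma codecomp_leq {X} {cX : Coded X} (f g : X -> nat) :
  codecomp f -> codecomp g -> codecomp (fun x => f x <= g x).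
Proof. by move=> hf hg; apply: codecomp_eq0; apply: codecomp_sub. Qed.
#[export] Hint Resolve codecomp_leq : codecomp.

Lemma codecomp_neg {X} {cX : Coded X} (f : X -> bool) :
  codecomp f -> codecomp (fun x => ~~ f x).
Proof.
move=> hf; have -> : (fun x => ~~ f x) = (fun x => if f x then false else true) by [].
solve_codecomp.
Qed.
#[export] Hint Resolve codecomp_neg : codecomp.

Lemma codecomp_and {X} {cX : Coded X} (f g : X -> bool) :
  codecomp f -> codecomp g -> codecomp (fun x => f x && g x).
Proof.
move=> hf hg; have -> : (fun x => f x && g x) = (fun x =>
  if f x then g x else false) by [].
solve_codecomp.
Qed.
#[export] Hint Resolve codecomp_and : codecomp.

Lemma codecomp_or {X} {cX : Coded X} (f g : X -> bool) :
  codecomp f -> codecomp g -> codecomp (fun x => f x || g x).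
Proof.
move=> hf hg; have -> : (fun x => f x || g x) = (fun x =>
  if f x then true else g x) by [].
solve_codecomp.
Qed.
#[export] Hint Resolve codecomp_or : codecomp.

Lemma codecomp_eqn {X} {cX : Coded X} (f g : X -> nat) :
  codecomp f -> codecomp g -> codecomp (fun x => f x == g x).
Proof.
move=> hf hg; have -> : (fun x => f x == g x) = (fun x => (f x <= g x) && (g x <= f x)).
  by apply/funext => x; rewrite eqn_leq.
by apply: codecomp_and; apply: codecomp_leq.
Qed.
#[export] Hint Resolve codecomp_eqn : codecomp.

Lemma codecomp_nunpair {X} {cX : Coded X} (f : X -> nat) :
  codecomp f -> codecomp (fun x => nunpair (f x)).
Proof.
apply: codecomp_comp; exists id; first exact: regcomp_id.
by move=> n; rewrite -{1}(nunpairK n).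
Qed.
#[export] Hint Resolve codecomp_nunpair : codecomp.

Lemma codecomp_decode {X} {cX : Coded X} (f : X -> nat) :
  codecomp f -> codecomp (fun x => CodeSeq.decode (f x)).
Proof.
apply: codecomp_comp; exists id; first exact: regcomp_id.
by move=> n; rewrite -{1}(CodeSeq.decodeK n) /ecode /Coded_seq /ecode /Coded_nat map_id.
Qed.
#[export] Hint Resolve codecomp_decode : codecomp.

Lemma codecomp_code {X} {cX : Coded X} (f : X -> seq nat) :
  codecomp f -> codecomp (fun x => CodeSeq.code (f x)).
Proof.
apply: codecomp_comp; exists id; first exact: regcomp_id.
by move=> s; rewrite /ecode /Coded_seq /ecode /Coded_nat map_id.
Qed.
#[export] Hint Resolve codecomp_code : codecomp.

Lemma codecomp_nat_of_bool {X} {cX : Coded X} (f : X -> bool) :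
  codecomp f -> codecomp (fun x => f x : nat).
Proof. by move=> [g hg e]; exists g. Qed.
#[export] Hint Resolve codecomp_nat_of_bool : codecomp.

Lemma codecomp_on_codes {A B} {cA : Coded A} {cB : Coded B} (h : nat -> nat) (f :
  A -> B) :
  codecomp h -> (forall a, h (ecode a) = ecode (f a)) -> codecomp f.
Proof. by move=> [g hg eg] e; exists g => // a; rewrite -e; exact: eg (ecode a). Qed.

Arguments codecomp_on_codes {A B cA cB} h {f}.

Section lists.
Context {X A B : Type} {cX : Coded X} {cA : Coded A} {cB : Coded B}.

Lemma ecode_cons (a : A) s : ecode (a :: s) = (npair (ecode a) (ecode s)).+1.
Proof. exact: code_cons. Qed.

Lemma codecomp_cons (f : X -> A) (g : X -> seq A) : codecomp f -> codecomp g ->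
  codecomp (fun x => f x :: g x).
Proof.
move=> [f' hf ef] [g' hg eg]; exists (fun n => (npair (f' n) (g' n)).+1).
  by apply: regcomp_comp regcomp_succ _; apply: regcomp_pair.
by move=> x; rewrite ecode_cons ef eg.
Qed.

Lemma codecomp_behead (f : X -> seq A) :
  codecomp f -> codecomp (fun x => behead (f x)).
Proof.
apply: codecomp_comp; apply: (codecomp_on_codes (fun n => (nunpair n.-1).2));
  first solve_codecomp.
by case=> [//|a s]; rewrite ecode_cons npairK.
Qed.

Lemma codecomp_nilp (f : X -> seq A) : codecomp f -> codecomp (fun x => nilp (f x)).
Proof.
apply: codecomp_comp; apply: (codecomp_on_codes (fun n => n == 0));
  first solve_codecomp.
by case=> [//|a s]; rewrite ecode_cons.
Qed.

Lemma codecomp_head a0 (f : X -> seq A) :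
  codecomp f -> codecomp (fun x => head a0 (f x)).
Proof.
apply: codecomp_comp.
apply: (codecomp_on_codes (fun n => if n == 0 then ecode a0 else (nunpair n.-1).1)).
  solve_codecomp.
by case=> [//|a s]; rewrite ecode_cons npairK.
Qed.

End lists.
#[export] Hint Resolve codecomp_cons codecomp_behead codecomp_nilp codecomp_head :
  codecomp.

Section folds.
Context {X A B : Type} {cX : Coded X} {cA : Coded A} {cB : Coded B}.

Lemma size_leq_ecode (s : seq A) : size s <= ecode s.
Proof.
elim: s => // a s IH; rewrite ecode_cons ltnS (leq_trans IH) //.
by rewrite /npair -ltnS prednK ?muln_gt0 ?expn_gt0 //; have := expn_gt0 2 (ecode a);
  nia.
Qed.

(** The code of a list bounds its length, so the fold is an iteration whose step does
    nothing once the list is empty. *)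
Lemma codecomp_foldl (h : X -> B -> A -> B) (i : X -> B) (l : X -> seq A) :
  codecomp (fun y : X * B * A => h y.1.1 y.1.2 y.2) -> codecomp i -> codecomp l ->
  codecomp (fun x => foldl (h x) (i x) (l x)).
Proof.
(* a default for the head of a list; without one all lists are empty *)
move=> hh hi hl; have [[a0 _]|noA] := pselect (exists a : A, True); last first.
  suff -> : (fun x => foldl (h x) (i x) (l x)) = i by [].
  by apply/funext => x; case: (l x) => // a; case: noA; exists a.
pose st x y := if nilp y.2 then y else (h x y.1 (head a0 y.2), behead y.2).
have -> : (fun x => foldl (h x) (i x) (l x))
          = (fun x => (iter (ecode (l x)) (st x) (i x, l x)).1).
  apply/funext => x; move: (ecode (l x)) (size_leq_ecode (l x)) (i x).
  move: (l x) => s n; elim: n s => [|n IH] s.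
    by rewrite leqn0 => /nilP ->.
  move=> le_s b; rewrite iterSr; case: s le_s => [|a s] le_s.
    by rewrite {2}/st /= -IH.
  by rewrite {2}/st /= -IH.
have hn : codecomp (fun x => ecode (l x)) by have [l' hl' el] := hl; exists l'.
have hst : codecomp (fun y : X * (B * seq A) => h y.1 y.2.1 (head a0 y.2.2)).
  apply: (@codecomp_comp _ _ _ _ _ _ (fun y : X * B * A => h y.1.1 y.1.2 y.2)
    (fun y : X * (B * seq A) => (y.1, y.2.1, head a0 y.2.2)) hh); solve_codecomp.
by apply: codecomp_fst; apply: codecomp_iter; rewrite ?/st; solve_codecomp.
Qed.

End folds.
#[export] Hint Resolve codecomp_foldl : codecomp.

Section derived.
Context {A B : Type} {cA : Coded A} {cB : Coded B}.

Lemma codecomp_rev {X} {cX : Coded X} (l : X -> seq A) :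
  codecomp l -> codecomp (fun x => rev (l x)).
Proof.
move=> hl; have -> : (fun x => rev (l x))
    = (fun x => foldl (fun s a => a :: s) [::] (l x)).
  by apply/funext => x; rewrite /rev; elim: (l x) [::] => //=.
solve_codecomp.
Qed.
#[local] Hint Resolve codecomp_rev : codecomp.

Lemma codecomp_foldr {X} {cX : Coded X} (h : X -> A -> B -> B) (i : X -> B) (l : X ->
  seq A) :
  codecomp (fun y : X * B * A => h y.1.1 y.2 y.1.2) -> codecomp i -> codecomp l ->
  codecomp (fun x => foldr (h x) (i x) (l x)).
Proof.
move=> hh hi hl.
have -> : (fun x => foldr (h x) (i x) (l x))
    = (fun x => foldl (fun b a => h x a b) (i x) (rev (l x))).
  by apply/funext => x; rewrite foldl_rev.
solve_codecomp.
Qed.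

Lemma codecomp_size {X} {cX : Coded X} (l : X -> seq A) :
  codecomp l -> codecomp (fun x => size (l x)).
Proof.
move=> hl; have -> : (fun x => size (l x))
    = (fun x => foldl (fun n _ => n.+1) 0 (l x)).
  apply/funext => x; rewrite -[LHS]addn0; elim: (l x) 0 => //= a s IH n.
  by rewrite -IH addnS.
solve_codecomp.
Qed.

Lemma codecomp_drop {X} {cX : Coded X} (n : X -> nat) (l : X -> seq A) :
  codecomp n -> codecomp l -> codecomp (fun x => drop (n x) (l x)).
Proof.
move=> hn hl; have -> : (fun x => drop (n x) (l x))
    = (fun x => iter (n x) (fun s => behead s) (l x)).
  by apply/funext => x; apply: drop_behead.
solve_codecomp.
Qed.
#[local] Hint Resolve codecomp_drop : codecomp.

Lemma codecomp_nth {X} {cX : Coded X} a0 (n : X -> nat) (l : X -> seq A) :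
  codecomp n -> codecomp l -> codecomp (fun x => nth a0 (l x) (n x)).
Proof.
move=> hn hl; have -> : (fun x => nth a0 (l x) (n x))
    = (fun x => head a0 (drop (n x) (l x))).
  by apply/funext => x; rewrite -nth0 nth_drop addn0.
solve_codecomp.
Qed.

Lemma codecomp_nseq {X} {cX : Coded X} (n : X -> nat) (a : X -> A) :
  codecomp n -> codecomp a -> codecomp (fun x => nseq (n x) (a x)).
Proof.
move=> hn ha; have -> : (fun x => nseq (n x) (a x))
    = (fun x => iter (n x) (fun s => a x :: s) [::]) by [].
have ha1 : codecomp (fun y : X * seq A => a y.1) by apply: codecomp_comp ha _;
  solve_codecomp.
solve_codecomp.
Qed.
End derived.
#[export] Hint Resolve codecomp_rev codecomp_foldr codecomp_size codecomp_drop
  codecomp_nth codecomp_nseq : codecomp.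

Section maps.
Context {A B : Type} {cA : Coded A} {cB : Coded B}.

Lemma codecomp_weaken {X C} {cX : Coded X} {cC : Coded C} (h : X -> A -> C) :
  codecomp (fun y : X * A => h y.1 y.2) ->
  codecomp (fun y : X * B * A => h y.1.1 y.2).
Proof.
move=> hh.
apply: (@codecomp_comp _ _ _ _ _ _ (fun y : X * A => h y.1 y.2)
         (fun y : X * B * A => (y.1.1, y.2)) hh); solve_codecomp.
Qed.

Lemma codecomp_cat {X} {cX : Coded X} (l m : X -> seq A) :
  codecomp l -> codecomp m -> codecomp (fun x => l x ++ m x).
Proof.
move=> hl hm; have -> : (fun x => l x ++ m x)
    = (fun x => foldr (fun a s => a :: s) (m x) (l x)).
  by apply/funext => x; elim: (l x) => //= a s ->.
solve_codecomp.
Qed.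

End maps.
#[export] Hint Resolve codecomp_cat : codecomp.

Lemma codecomp_map {X A B} {cX : Coded X} {cA : Coded A} {cB : Coded B}
    (h : X -> A -> B) (l : X -> seq A) :
  codecomp (fun y : X * A => h y.1 y.2) -> codecomp l -> codecomp (fun x =>
    map (h x) (l x)).
Proof.
move=> /(@codecomp_weaken _ (seq B)) hh hl; have -> : (fun x => map (h x) (l x))
    = (fun x => foldr (fun a s => h x a :: s) [::] (l x)) by [].
solve_codecomp.
Qed.

Lemma codecomp_has {X A} {cX : Coded X} {cA : Coded A}
    (h : X -> A -> bool) (l : X -> seq A) :
  codecomp (fun y : X * A => h y.1 y.2) -> codecomp l -> codecomp (fun x =>
    has (h x) (l x)).
Proof.
move=> /(@codecomp_weaken _ bool) hh hl; have -> : (fun x => has (h x) (l x))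
    = (fun x => foldr (fun a b => h x a || b) false (l x)) by [].
solve_codecomp.
Qed.

Lemma codecomp_all {X A} {cX : Coded X} {cA : Coded A}
    (h : X -> A -> bool) (l : X -> seq A) :
  codecomp (fun y : X * A => h y.1 y.2) -> codecomp l -> codecomp (fun x =>
    all (h x) (l x)).
Proof.
move=> /(@codecomp_weaken _ bool) hh hl; have -> : (fun x => all (h x) (l x))
    = (fun x => foldr (fun a b => h x a && b) true (l x)) by [].
solve_codecomp.
Qed.

Lemma codecomp_filter {X A} {cX : Coded X} {cA : Coded A}
    (h : X -> A -> bool) (l : X -> seq A) :
  codecomp (fun y : X * A => h y.1 y.2) -> codecomp l -> codecomp (fun x =>
    seq.filter (h x) (l x)).
Proof.
move=> /(@codecomp_weaken _ (seq A)) hh hl; have -> : (fun x => seq.filter (h x) (l x))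
    = (fun x => foldr (fun a s => if h x a then a :: s else s) [::] (l x)) by [].
solve_codecomp.
Qed.
#[export] Hint Resolve codecomp_map codecomp_has codecomp_all codecomp_filter :
  codecomp.

Lemma codecomp_flatten {X A} {cX : Coded X} {cA : Coded A} (l : X -> seq (seq A)) :
  codecomp l -> codecomp (fun x => flatten (l x)).
Proof.
move=> hl; have -> : (fun x => flatten (l x)) = (fun x => foldr cat [::] (l x)) by [].
solve_codecomp.
Qed.

Lemma codecomp_iota {X} {cX : Coded X} (m n : X -> nat) :
  codecomp m -> codecomp n -> codecomp (fun x => iota (m x) (n x)).
Proof.
move=> hm hn; have -> : (fun x => iota (m x) (n x))
  = (fun x => rev (iter (n x) (fun y => (y.1.+1, y.1 :: y.2)) (m x, [::])).2).
  apply/funext => x; rewrite -[LHS]revK; congr rev.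
  suff -> : iter (n x) (fun y => (y.1.+1, y.1 :: y.2)) (m x, [::])
            = (m x + n x, rev (iota (m x) (n x))) by [].
  elim: (n x) => [|k /= ->] /=; first by rewrite addn0.
  by rewrite -/(iota (m x) k.+1) -[k.+1]addn1 iotaD cats1 rev_rcons addn1 addnS.
solve_codecomp.
Qed.
#[export] Hint Resolve codecomp_flatten codecomp_iota : codecomp.

Lemma codecomp_take {X A} {cX : Coded X} {cA : Coded A} (n : X -> nat) (l : X ->
  seq A) :
  codecomp n -> codecomp l -> codecomp (fun x => take (n x) (l x)).
Proof.
move=> hn hl; have -> : (fun x => take (n x) (l x))
  = (fun x => rev (drop (size (l x) - n x) (rev (l x)))).
  by apply/funext => x; rewrite -{1}[l x]revK take_rev size_rev.
solve_codecomp.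
Qed.

Lemma codecomp_mem {X} {cX : Coded X} (n : X -> nat) (l : X -> seq nat) :
  codecomp n -> codecomp l -> codecomp (fun x => n x \in l x).
Proof.
move=> hn hl; have -> : (fun x => n x \in l x) = (fun x => has (fun m =>
  m == n x) (l x)).
  by apply/funext => x; rewrite -has_pred1.
have hn1 : codecomp (fun y : X * nat => n y.1) by apply: codecomp_comp hn _;
  solve_codecomp.
solve_codecomp.
Qed.
#[export] Hint Resolve codecomp_take codecomp_mem : codecomp.

(** * Simulating machines *)

Lemma in_pos_run M inp t : in_pos (run M inp t) <= t.
Proof.
elim: t => // t; rewrite /run iterS -/(run M inp t).
case: (run M inp t) => p k w o /= le_k; rewrite /step.
by case: onth => [[]|] /=; lia.
Qed.

(** At time [t] at most the first [t] symbols of the input have been read. *)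
Lemma run_agree M inp inp' t : (forall j, j < t -> inp j = inp' j) ->
  run M inp t = run M inp' t.
Proof.
elim: t => // t IH h; rewrite /run !iterS -!/(run _ _ t) -IH => [|j lt_j]; last first.
  by apply: h; apply: ltnW.
have := in_pos_run M inp t; case: (run M inp t) => p k w o /= le_k; rewrite /step.
by case: onth => // -[] //= l; rewrite h.
Qed.

Lemma out_run M inp t t' : t <= t' -> prefix (out (run M inp t)) (out (run M inp t')).
Proof.
move=> /subnK <-; elim: (t' - t) => [|n IH]; first exact: prefix_refl.
apply: prefix_trans IH _; rewrite addSn /run iterS.
case: (iter (n + t) _ _) => p k w o; rewrite /step /=.
by case: onth => [[]|] //=; try move=> *; rewrite ?prefix_refl // prefix_rcons.
Qed.

Lemma halted_run M inp t t' : t <= t' -> size M <= pc (run M inp t) ->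
  run M inp t' = run M inp t.
Proof.
move=> /subnK <- h; elim: (t' - t) => // n IH.
rewrite addSn /run iterS -/(run M inp (n + t)) IH /step.
by rewrite onth_default.
Qed.

(* [tape] is unfolded here, since codes are found by the syntax of types.  In a
   simulated configuration the work tapes form an association list in which the
   newest entry for a tape counts, and the output is reversed. *)
Local Notation raw_tape := (seq nat * nat * seq nat)%type.
Local Notation conf := ((nat * nat) * (seq (nat * raw_tape) * seq bool))%type.

Definition lookup (i : nat) (ws : seq (nat * raw_tape)) : raw_tape :=
  foldr (fun e t => if e.1 == i then e.2 else t) ([::], 0, [::]) ws.

Definition raw_left (t : raw_tape) : raw_tape :=
  (behead t.1.1, head 0 t.1.1, t.1.2 :: t.2).

Definition raw_right (t : raw_tape) : raw_tape :=
  (t.1.2 :: t.1.1, head 0 t.2, behead t.2).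

Definition set_tape (i : nat) (t : raw_tape) (c : conf) : conf :=
  ((c.1.1.+1, c.1.2), ((i, t) :: c.2.1, c.2.2)).

Definition exec_code (l : seq nat) (x : seq bool) (c : conf) : conf :=
  if (head 0 l == 0) && (size l == 2) then
    set_tape (nth 0 l 1) (raw_left (lookup (nth 0 l 1) c.2.1)) c
  else if (head 0 l == 1) && (size l == 2) then
    set_tape (nth 0 l 1) (raw_right (lookup (nth 0 l 1) c.2.1)) c
  else if (head 0 l == 2) && (size l == 3) then
    set_tape (nth 0 l 1) ((lookup (nth 0 l 1) c.2.1).1.1, nth 0 l 2,
                          (lookup (nth 0 l 1) c.2.1).2) c
  else if (head 0 l == 3) && (size l == 4) then
    (((if (lookup (nth 0 l 1) c.2.1).1.2 == nth 0 l 2 then nth 0 l 3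
       else c.1.1.+1), c.1.2), c.2)
  else if (head 0 l == 4) && (size l == 2) then
    (((if nth false x c.1.2 then nth 0 l 1 else c.1.1.+1), c.1.2), c.2)
  else if (head 0 l == 5) && (size l == 2) then
    ((c.1.1.+1, c.1.2), (c.2.1, (~~ (nth 0 l 1 == 0)) :: c.2.2))
  else ((c.1.1.+1, c.1.2.+1), c.2).

Definition sim_step (M : seq nat) (x : seq bool) (c : conf) : conf :=
  if size M <= c.1.1 then c
  else exec_code (CodeSeq.decode (nth 0 M c.1.1)) x c.

(** The machine is run on the tape of the finite word [v] for [size v] steps.  In this
    time it cannot read beyond [v], so it behaves as on all inputs that extend [v]. *)
Definition sim_run (e : nat) (v : seq nat) : conf :=
  iter (size v) (sim_step (CodeSeq.decode e) (unary v)) ((0, 0), ([::], [::])).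

Definition sim (e : nat) (v : seq nat) : seq nat :=
  decode_unary (rev (sim_run e v).2.2).

Definition sim_halts (e : nat) (v : seq nat) : bool :=
  size (CodeSeq.decode e) <= (sim_run e v).1.1.

Definition sim_rel (c : config) (d : conf) : Prop :=
  [/\ pc c = d.1.1, in_pos c = d.1.2, forall i, work c i = lookup i d.2.1 &
      out c = rev d.2.2].

Lemma sim_rel_exec n x c d : sim_rel c d ->
  sim_rel (exec (nth false x) (instr_of n) c) (exec_code (CodeSeq.decode n) x d).
Proof.
rewrite /instr_of; move: (CodeSeq.decode n) => l.
case: c d => p k w o [[p' k'] [ws o']] [/= -> -> hw ->].
have upd_rel f i t : t = f (lookup i ws) ->
    forall j, upd_tape w i f j = lookup j ((i, t) :: ws).
  move=> -> j; rewrite /upd_tape /= [i == j]eq_sym hw.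
  by case: eqP => [->|].
rewrite /exec_code.
case: l => [|[|[|[|[|[|[|a]]]]]] [|i [|s [|q [|r l]]]]] //=; split=> //=;
  rewrite ?hw ?rev_cons //; apply: upd_rel; rewrite ?hw; by case: lookup => [[u m] v].
Qed.

Lemma sim_runP e v :
  sim_rel (run (machine e) (nth false (unary v)) (size v)) (sim_run e v).
Proof.
rewrite /run /sim_run; elim: (size v) => [|t IH]; first by split.
rewrite !iterS; move: (iter t _ _) (iter t _ _) IH => c d r.
rewrite /step /sim_step; have [<- _ _ _] := r.
case: leqP => h; first by rewrite onth_default // size_map.
by rewrite /machine onthE -map_comp (nth_map 0) //; apply: sim_rel_exec.
Qed.

Lemma codecomp_lookup {X} {cX : Coded X} (i : X -> nat) (ws : X ->
  seq (nat * raw_tape)) :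
  codecomp i -> codecomp ws -> codecomp (fun x => lookup (i x) (ws x)).
Proof.
apply: codecomp_app2; rewrite /lookup; solve_codecomp.
Qed.
#[export] Hint Resolve codecomp_lookup : codecomp.

Lemma codecomp_exec_code :
  codecomp (fun y : seq nat * seq bool * conf => exec_code y.1.1 y.1.2 y.2).
Proof. by rewrite /exec_code /set_tape /raw_left /raw_right; solve_codecomp. Qed.

Lemma codecomp_unary {X} {cX : Coded X} (s : X -> seq nat) :
  codecomp s -> codecomp (fun x => unary (s x)).
Proof.
apply: (@codecomp_comp _ _ _ _ _ _ unary); rewrite /unary.
have -> : (fun s => flatten [seq rcons (nseq n true) false | n <- s])
  = (fun s => flatten [seq nseq n true ++ [:: false] | n <- s]).
  by apply/funext => u; congr flatten; apply: eq_map => n; rewrite cats1.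
solve_codecomp.
Qed.

Lemma codecomp_decode_unary {X} {cX : Coded X} (s : X -> seq bool) :
  codecomp s -> codecomp (fun x => decode_unary (s x)).
Proof.
apply: (@codecomp_comp _ _ _ _ _ _ decode_unary); rewrite /decode_unary /scan.
solve_codecomp.
Qed.
#[export] Hint Resolve codecomp_unary codecomp_decode_unary : codecomp.

Lemma codecomp_sim_run {X} {cX : Coded X} (e : X -> nat) (v : X -> seq nat) :
  codecomp e -> codecomp v -> codecomp (fun x => sim_run (e x) (v x)).
Proof.
apply: codecomp_app2; rewrite /sim_run /sim_step.
have h : codecomp (fun y : nat * seq nat * conf => exec_code
   (CodeSeq.decode (nth 0 (CodeSeq.decode y.1.1) y.2.1.1)) (unary y.1.2) y.2).
  by apply: (codecomp_app3 codecomp_exec_code); solve_codecomp.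
solve_codecomp.
Qed.
#[export] Hint Resolve codecomp_sim_run : codecomp.

Lemma codecomp_sim {X} {cX : Coded X} (e : X -> nat) (v : X -> seq nat) :
  codecomp e -> codecomp v -> codecomp (fun x => sim (e x) (v x)).
Proof. by move=> he hv; rewrite /sim; solve_codecomp. Qed.

Lemma codecomp_sim_halts {X} {cX : Coded X} (e : X -> nat) (v : X -> seq nat) :
  codecomp e -> codecomp v -> codecomp (fun x => sim_halts (e x) (v x)).
Proof. by move=> he hv; rewrite /sim_halts; solve_codecomp. Qed.
#[export] Hint Resolve codecomp_sim codecomp_sim_halts : codecomp.

Lemma simE e v : sim e v =
  decode_unary (out (run (machine e) (nth false (unary v)) (size v))).
Proof. by have [_ _ _ ->] := sim_runP e v. Qed.

Lemma sim_haltsE e v : sim_halts e v =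
  (size (machine e) <= pc (run (machine e) (nth false (unary v)) (size v))).
Proof. by have [-> _ _ _] := sim_runP e v; rewrite size_map. Qed.

Lemma size_unary_ge v : size v <= size (unary v).
Proof.
have := entry_pos_ge (nth 0 v) (size v).
by rewrite /entry_pos mkseq_nth.
Qed.

Lemma run_prefix e v v' t : prefix v v' -> t <= size v ->
  run (machine e) (nth false (unary v)) t = run (machine e) (nth false (unary v')) t.
Proof.
move=> /prefixP[u ->] le_t; apply: run_agree => j lt_j.
by rewrite unary_cat nth_cat (leq_trans lt_j) // (leq_trans le_t) // size_unary_ge.
Qed.

Lemma sim_prefix e v v' : prefix v v' -> prefix (sim e v) (sim e v').
Proof.
move=> hv; rewrite !simE (run_prefix _ hv) //.
have /prefixP[u ->] := out_run (machine e) (nth false (unary v')) (size_prefix hv).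
by have [s ->] := decode_unary_cat (out (run (machine e) (nth false (unary v')) (size
  v))) u;
  apply: prefix_prefix.
Qed.

Lemma sim_halts_prefix e v v' : prefix v v' -> sim_halts e v -> sim_halts e v'.
Proof.
move=> hv; rewrite !sim_haltsE (run_prefix _ hv) // => h.
by rewrite (halted_run (size_prefix hv)).
Qed.

Lemma prefix_mkseq (p : baire) m n : m <= n -> prefix (mkseq p m) (mkseq p n).
Proof.
by move=> /subnKC <-; rewrite /mkseq iotaD map_cat prefix_prefix.
Qed.

Lemma run_mkseq e p s t : t <= s ->
  run (machine e) (nth false (unary (mkseq p s))) t = run (machine e) (tape_of p) t.
Proof.
move=> le_t; apply: run_agree => j lt_j; apply: nth_unary.
by rewrite (leq_trans lt_j) // (leq_trans le_t) // entry_pos_ge.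
Qed.

Lemma Phi_out e p q t : Phi e p q ->
  out (run (machine e) (tape_of p) t)
  = mkseq (tape_of q) (size (out (run (machine e) (tape_of p) t))).
Proof.
move=> h; set o := out _; apply: (@eq_from_nth _ false) => [|k lt_k].
  by rewrite size_mkseq.
rewrite nth_mkseq //; have [t' [lt_k' <-]] := h k.
have /prefixP[u e1] := out_run (machine e) (tape_of p) (leq_maxl t t').
have /prefixP[u' e2] := out_run (machine e) (tape_of p) (leq_maxr t t').
have -> : nth false o k = nth false (out (run (machine e) (tape_of p) (maxn t t'))) k.
  by rewrite e1 nth_cat lt_k.
by rewrite e2 nth_cat lt_k'.
Qed.

Lemma sim_Phi e p q s : Phi e p q ->
  sim e (mkseq p s) = mkseq q (size (sim e (mkseq p s))).
Proof.
move=> h; rewrite simE size_mkseq run_mkseq // (Phi_out _ h).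
by have [n -> _] := decode_unary_tape_of q (size (out (run (machine e) (tape_of p) s)));
  rewrite size_mkseq.
Qed.

(** Longer prefixes give more steps, so every entry of the output is reached. *)
Lemma sim_Phi_size e p q n : Phi e p q -> exists s, n <= size (sim e (mkseq p s)).
Proof.
move=> h; have [t [lt_o _]] := h (entry_pos q n).
exists t; rewrite simE size_mkseq run_mkseq // (Phi_out _ h).
have [m -> /andP[_ lt_m]] := decode_unary_tape_of q (size (out (run (machine e)
  (tape_of p) t))).
rewrite size_mkseq leqNgt; apply/negP => /(leq_entry_pos q); lia.
Qed.

Lemma halts_sim e p :
  halts (machine e) (tape_of p) <-> exists s, sim_halts e (mkseq p s).
Proof.
by split=> -[s hs]; exists s; move: hs; rewrite sim_haltsE size_mkseq run_mkseq.
Qed.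

(** * Certificates that a tree of names has no branch *)

Definition interleave (q : nat -> nat) (w : seq nat) : seq nat :=
  flatten [seq [:: q k; nth 0 w k] | k <- iota 0 (size w)].

(** If [p] names a closed set and [w] is a prefix of a name of [x], then the simulated
    machine reports that [x] lies outside by the entry 0. *)
Definition outside (p : nat -> nat) (w : seq nat) : bool :=
  0 \in sim (p 0) (interleave (fun k => p k.+1) w).

(** The inputs that define [ce_words] are the code of a word followed by zeros; [s] of
    these zeros are supplied, hence [s.+1] steps. *)
Definition enters (m s : nat) (w : seq nat) : bool :=
  has (fun l => sim_halts m (CodeSeq.code (take l w) :: nseq s 0))
      (iota 0 (size w).+1).

(** [b m = 0] says that [U_m] is to be avoided. *)
Definition enters_some (b : seq nat) (s : nat) (w : seq nat) : bool :=
  has (fun m => (nth 1 b m == 0) && enters m s w) (iota 0 (size b)).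

(** [2 ^- m + 2 ^- j.+1 < rat_of v], without fractions. *)
Definition exceeds (j m v : nat) : bool :=
  (nunpair (nunpair v).1).2 * 2 ^ (m + j.+1)
    + (nunpair v).2.+1 * (2 ^ j.+1 + 2 ^ m)
  < (nunpair (nunpair v).1).1 * 2 ^ (m + j.+1).

(** [rat_of j <= 2 ^- k.+2], without fractions. *)
Definition small_radius (k j : nat) : bool :=
  (nunpair (nunpair j).1).1 * 2 ^ k.+2
  <= (nunpair (nunpair j).1).2 * 2 ^ k.+2 + (nunpair j).2.+1.

Definition fine_cover (k v : nat) : bool :=
  all (fun c => small_radius k (nunpair c).2) (CodeSeq.decode v).

Definition centers (v : nat) : seq nat :=
  [seq (nunpair c).1 | c <- CodeSeq.decode v].

(** In this section [eD] and [eK] are the numbers of machines for the distance of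
    centres and for the kappa-names of the pieces. *)
Section search.
Variables eD eK : nat.

(** Entry [m] of a name of the distance is correct up to [2 ^- m]. *)
Definition far (s a b j : nat) : bool :=
  has (fun m => exceeds j m (nth 0 (sim eD [:: a, b & nseq s 0]) m))
      (iota 0 (size (sim eD [:: a, b & nseq s 0]))).

(** What remains satisfies the condition that distances are at most [2 ^- j.+1]: it is
    closed, it implies the strict bound [2 ^- j] of Cauchy names, and every point of
    a piece has a name that satisfies it. *)
Definition not_cauchy (s : nat) (w : seq nat) : bool :=
  has (fun i => has (fun j => far s (nth 0 w i) (nth 0 w j) j) (iota 0 i))
      (iota 0 (size w)).

Definition killed (p : nat -> nat) (b : seq nat) (s : nat) (w : seq nat) : bool :=
  [|| outside p w, enters_some b s w | not_cauchy s w].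

Definition fine_covers (i k s : nat) : seq nat :=
  [seq v <- sim eK (i :: nseq s 0) | fine_cover k v].

Definition words (i s l : nat) : seq (seq nat) :=
  foldl (fun ws k => flatten
     [seq [seq w ++ [:: a] | a <- centers (head 0 (fine_covers i k s))] | w <- ws])
   [:: [::]] (iota 0 l).

(** A finite certificate that a tree has no branch: for some [l] the first [l] levels
    are known at stage [s], and so is a reason to remove each word of length [l]. *)
Definition refuted (p : nat -> nat) (i : nat) (b : seq nat) (s : nat) : bool :=
  has (fun l => all (fun k => ~~ nilp (fine_covers i k s)) (iota 0 l) &&
                all (fun w => killed p b s w) (words i s l)) (iota 0 s.+1).

Definition seen_empty (p : nat -> nat) (t i : nat) (b : seq nat) : bool :=
  has (fun s => refuted p i b s) (iota 0 t.+1).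

(** By default 0, if all pieces up to [t] have been seen to be empty. *)
Definition current_piece (p : nat -> nat) (t : nat) : nat :=
  head 0 [seq i <- iota 0 t.+1 | ~~ seen_empty p t i [::]].

(** The value 1 if it seems impossible to avoid one more set, where [b] lists the
    earlier bits. *)
Definition guess (p : nat -> nat) (t : nat) (b : seq nat) : nat :=
  seen_empty p t (current_piece p t) (b ++ [:: 0]).

Definition bits (p : nat -> nat) (t n : nat) : seq nat :=
  iter n (fun b => b ++ [:: guess p t b]) [::].

(** The guess for entry [n] at stage [t], if [c] codes, in reverse, a
    prefix of length [(npair t n).+1]. *)
Definition output (c : nat) : nat :=
  guess (nth 0 (rev (CodeSeq.decode c))) (nunpair (size (CodeSeq.decode c)).-1).1
    (bits (nth 0 (rev (CodeSeq.decode c))) (nunpair (size (CodeSeq.decode c)).-1).1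
       (nunpair (size (CodeSeq.decode c)).-1).2).

Lemma codecomp_outside {X} {cX : Coded X} (p w : X -> seq nat) :
  codecomp p -> codecomp w -> codecomp (fun x => outside (nth 0 (p x)) (w x)).
Proof.
apply: (codecomp_app2 (h := fun p w => outside (nth 0 p) w)).
by rewrite /outside /interleave; solve_codecomp.
Qed.

Lemma codecomp_enters {X} {cX : Coded X} (m s : X -> nat) (w : X -> seq nat) :
  codecomp m -> codecomp s -> codecomp w -> codecomp (fun x =>
    enters (m x) (s x) (w x)).
Proof. apply: codecomp_app3; rewrite /enters; solve_codecomp. Qed.
#[local] Hint Resolve codecomp_outside codecomp_enters : codecomp.

Lemma codecomp_exceeds {X} {cX : Coded X} (j m v : X -> nat) :
  codecomp j -> codecomp m -> codecomp v -> codecomp (fun x =>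
    exceeds (j x) (m x) (v x)).
Proof. apply: codecomp_app3; rewrite /exceeds; solve_codecomp. Qed.

Lemma codecomp_fine_cover {X} {cX : Coded X} (k v : X -> nat) :
  codecomp k -> codecomp v -> codecomp (fun x => fine_cover (k x) (v x)).
Proof. apply: codecomp_app2; rewrite /fine_cover /small_radius; solve_codecomp. Qed.
#[local] Hint Resolve codecomp_exceeds codecomp_fine_cover : codecomp.

Lemma codecomp_killed {X} {cX : Coded X} (p b : X -> seq nat) (s : X -> nat) (w :
  X -> seq nat) :
  codecomp p -> codecomp b -> codecomp s -> codecomp w ->
  codecomp (fun x => killed (nth 0 (p x)) (b x) (s x) (w x)).
Proof.
move=> hp hb; apply: (codecomp_app3
  (h := fun y s w => killed (nth 0 y.1) y.2 s w) _ (codecomp_pair hp hb)).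
by rewrite /killed /enters_some /not_cauchy /far; solve_codecomp.
Qed.

Lemma codecomp_fine_covers {X} {cX : Coded X} (i k s : X -> nat) :
  codecomp i -> codecomp k -> codecomp s -> codecomp (fun x =>
    fine_covers (i x) (k x) (s x)).
Proof. apply: codecomp_app3; rewrite /fine_covers; solve_codecomp. Qed.
#[local] Hint Resolve codecomp_killed codecomp_fine_covers : codecomp.

Lemma codecomp_words {X} {cX : Coded X} (i s l : X -> nat) :
  codecomp i -> codecomp s -> codecomp l -> codecomp (fun x => words (i x) (s x) (l x)).
Proof. apply: codecomp_app3; rewrite /words /centers; solve_codecomp. Qed.
#[local] Hint Resolve codecomp_words : codecomp.

Lemma codecomp_seen {X} {cX : Coded X} (p : X -> seq nat) (t i : X -> nat) (b : X ->
  seq nat) :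
  codecomp p -> codecomp t -> codecomp i -> codecomp b ->
  codecomp (fun x => seen_empty (nth 0 (p x)) (t x) (i x) (b x)).
Proof.
move=> hp ht; apply: (codecomp_app3
  (h := fun y i b => seen_empty (nth 0 y.1) y.2 i b) _ (codecomp_pair hp ht)).
by rewrite /seen_empty /refuted; solve_codecomp.
Qed.
#[local] Hint Resolve codecomp_seen : codecomp.

Lemma codecomp_guess {X} {cX : Coded X} (p : X -> seq nat) (t : X -> nat) (b : X ->
  seq nat) :
  codecomp p -> codecomp t -> codecomp b -> codecomp (fun x =>
    guess (nth 0 (p x)) (t x) (b x)).
Proof.
apply: (codecomp_app3 (h:=fun p t b => guess (nth 0 p) t b)).
by rewrite /guess /current_piece; solve_codecomp.
Qed.
#[local] Hint Resolve codecomp_guess : codecomp.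

Lemma regcomp_output : regcomp output.
Proof.
have [g hg e] : @codecomp nat nat _ _ output; last by apply: regcomp_eq hg => n;
  exact: e.
by rewrite /output /bits; solve_codecomp.
Qed.

Lemma eq_killed p p' b s w : (forall j, j <= size w -> p j = p' j) ->
  killed p b s w = killed p' b s w.
Proof.
move=> h; rewrite /killed; suff -> : outside p w = outside p' w by [].
rewrite /outside (h 0 (leq0n _)).
suff -> : interleave (fun k => p k.+1) w = interleave (fun k => p' k.+1) w by [].
congr flatten; apply/eq_in_map => k; rewrite mem_iota add0n => /andP[_ lt_k].
by rewrite h.
Qed.

Lemma words_size i s l w : w \in words i s l -> size w = l.
Proof.
elim: l w => [|l IH] w; first by rewrite inE => /eqP ->.
rewrite /words -[l.+1]addn1 iotaD foldl_cat -/(words i s l) /=.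
by move=> /flatten_mapP[u /IH <- /mapP[a _ ->]]; rewrite size_cat.
Qed.

Lemma mem_words i s l w : (w \in words i s l) =
  (size w == l) && all (fun k => nth 0 w k \in centers (head 0 (fine_covers i k s)))
    (iota 0 l).
Proof.
elim: l w => [|l IH] w; first by rewrite inE andbT size_eq0.
rewrite /words -[l.+1]addn1 iotaD foldl_cat -/(words i s l) /= add0n all_cat /= andbT
  addn1.
apply/flatten_mapP/idP => [[u hu /mapP[a ha ->]]|/andP[/eqP sw /andP[h1 h2]]].
  move: hu; rewrite IH => /andP[/eqP su hall].
  rewrite cats1 size_rcons su eqxx /= nth_rcons su ltnn eqxx ha andbT.
  apply/allP => k hk; have := allP hall k hk; move: hk.
  by rewrite mem_iota add0n => /andP[_ lt_k]; rewrite nth_rcons su lt_k.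
case/lastP: w sw h1 h2 => // u a; rewrite size_rcons => -[su] h1.
rewrite nth_rcons su ltnn eqxx => ha.
exists u; last by apply/mapP; exists a; rewrite ?cats1.
rewrite IH su eqxx; apply/allP => k hk; have := allP h1 k hk; move: hk.
by rewrite mem_iota add0n => /andP[_ lt_k]; rewrite nth_rcons su lt_k.
Qed.

Lemma eq_seen p p' t i b : (forall j, j <= t -> p j = p' j) ->
  seen_empty p t i b = seen_empty p' t i b.
Proof.
move=> h; apply: eq_in_has => s; rewrite mem_iota add0n ltnS => /andP[_ le_s].
apply: eq_in_has => l; rewrite mem_iota add0n ltnS => /andP[_ le_l].
congr (_ && _); apply: eq_in_all => w /words_size sw; apply: eq_killed => j le_j.
by apply: h; rewrite (leq_trans le_j) // sw (leq_trans le_l).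
Qed.

Lemma eq_guess p p' t b : (forall j, j <= t -> p j = p' j) ->
  guess p t b = guess p' t b.
Proof.
move=> h; rewrite /guess.
have -> : current_piece p t = current_piece p' t.
  have E : (fun i => ~~ seen_empty p t i [::]) = (fun i => ~~ seen_empty p' t i [::]).
    by apply/funext => i; rewrite (eq_seen _ _ h).
  exact: (congr1 (fun f => head 0 (seq.filter f (iota 0 t.+1))) E).
by rewrite (eq_seen _ _ h).
Qed.

Lemma npair_ge i j : i <= npair i j.
Proof.
rewrite /npair -ltnS prednK ?muln_gt0 ?expn_gt0 //.
by rewrite (leq_trans (ltn_expl i (isT : 1 < 2))) // leq_pmulr.
Qed.

Lemma bits_agree p p' t n :
  (forall j, j <= t -> p j = p' j) -> bits p t n = bits p' t n.
Proof. move=> h.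
have E : guess p t = guess p' t by apply/funext => b; apply: eq_guess.
by rewrite /bits E. Qed.

(** Since [t <= npair t n], the prefix read by then contains all that stage [t] uses. *)
Lemma stream_output p t n :
  stream output p (npair t n) = guess p t (bits p t n).
Proof.
rewrite /stream /output CodeSeq.codeK revK size_rev size_mkseq succnK npairK /fst /snd.
have h j : j <= t -> nth 0 (mkseq p (npair t n).+1) j = p j.
  by move=> le_j; rewrite nth_mkseq // ltnS (leq_trans le_j) ?npair_ge.
by rewrite (eq_guess _ h) (bits_agree _ h).
Qed.

Lemma prefix_nseq s s' (u : seq nat) :
  s <= s' -> prefix (u ++ nseq s 0) (u ++ nseq s' 0).
Proof.
by move=> /subnKC <-; rewrite nseqD catA prefix_prefix.
Qed.

Lemma prefix_nth (x0 : nat) (u v : seq nat) i :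
  prefix u v -> i < size u -> nth x0 v i = nth x0 u i.
Proof. by move=> /prefixP[w ->] h; rewrite nth_cat h. Qed.

Lemma prefix_mem (u v : seq nat) a : prefix u v -> a \in u -> a \in v.
Proof. by move=> /prefixP[w ->]; rewrite mem_cat => ->. Qed.

Lemma prefix_interleave q w w' :
  prefix w w' -> prefix (interleave q w) (interleave q w').
Proof.
move=> hw; rewrite /interleave -(subnKC (size_prefix hw)) iotaD map_cat flatten_cat.
set u := flatten _; set v := flatten _; suff -> : u = v by rewrite prefix_prefix.
congr flatten; apply/eq_in_map => k; rewrite mem_iota add0n => /andP[_ lt_k].
by rewrite (prefix_nth _ hw).
Qed.

Lemma outside_prefix p w w' : prefix w w' -> outside p w -> outside p w'.
Proof. by move=> hw; apply: prefix_mem; apply: sim_prefix;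
  apply: prefix_interleave. Qed.

Lemma enters_prefix m s s' w w' :
  s <= s' -> prefix w w' -> enters m s w -> enters m s' w'.
Proof.
move=> le_s hw /hasP[l]; rewrite mem_iota add0n ltnS => /andP[_ le_l] h.
apply/hasP; exists l.
  by rewrite mem_iota add0n ltnS /= (leq_trans le_l) ?size_prefix.
have -> : take l w' = take l w by have /prefixP[u ->] := hw; rewrite takel_cat.
by apply: sim_halts_prefix h; exact: (@prefix_nseq _ _ [:: _]).
Qed.

Lemma enters_some_prefix b b' s s' w w' : prefix b b' -> s <= s' -> prefix w w' ->
  enters_some b s w -> enters_some b' s' w'.
Proof.
move=> hb le_s hw /hasP[m]; rewrite mem_iota add0n => /andP[_ lt_m] /andP[bm h].
apply/hasP; exists m; first by rewrite mem_iota add0n /= (leq_trans lt_m) ?size_prefix.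
by rewrite (prefix_nth _ hb lt_m) bm (enters_prefix le_s hw).
Qed.

Lemma far_leq s s' a b j : s <= s' -> far s a b j -> far s' a b j.
Proof.
move=> le_s /hasP[m]; rewrite mem_iota add0n => /andP[_ lt_m] h.
have hp := sim_prefix eD (prefix_nseq [:: a; b] le_s).
apply/hasP; exists m; first by rewrite mem_iota add0n /= (leq_trans lt_m) ?size_prefix.
by rewrite (prefix_nth _ hp).
Qed.

Lemma not_cauchy_prefix s s' w w' :
  s <= s' -> prefix w w' -> not_cauchy s w -> not_cauchy s' w'.
Proof.
move=> le_s hw /hasP[i]; rewrite mem_iota add0n => /andP[_ lt_i] /hasP[j].
rewrite mem_iota add0n => /andP[_ lt_j] h.
apply/hasP; exists i; first by rewrite mem_iota add0n /= (leq_trans lt_i) ?size_prefix.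
apply/hasP; exists j; first by rewrite mem_iota add0n.
rewrite (prefix_nth _ hw lt_i) (prefix_nth _ hw (ltn_trans lt_j lt_i)).
exact: far_leq le_s h.
Qed.

Lemma killed_prefix p b b' s s' w w' : prefix b b' -> s <= s' -> prefix w w' ->
  killed p b s w -> killed p b' s' w'.
Proof.
move=> hb hs hw; rewrite /killed.
case/or3P => [/(outside_prefix hw) ->//|/(enters_some_prefix hb hs hw) ->|
  /(not_cauchy_prefix hs hw) ->]; by rewrite !orbT.
Qed.

End search.

(** * Koenig's lemma and the completeness of certificates *)

Lemma uniform_bound (T : eqType) (L : seq T) (P : T -> nat -> Prop) :
  (forall x m n, m <= n -> P x m -> P x n) ->
  (forall x, x \in L -> exists n, P x n) ->
  exists n, forall x, x \in L -> P x n.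
Proof.
move=> mono; elim: L => [|a L IH] h; first by exists 0.
have [x xL|n hn] := IH; first by apply: h; rewrite inE xL orbT.
have [m hm] := h a (mem_head _ _).
exists (maxn m n) => x; rewrite inE => /predU1P[->|/hn].
  by apply: mono hm; apply: leq_maxl.
by apply: mono; apply: leq_maxr.
Qed.

(** The branch is built from words that have extensions in [T] of every length: were
    none of the finitely many successors of such a word of this kind, the lengths of
    their extensions would have a common bound. *)
Lemma koenig (T : seq nat -> Prop) (B : nat -> seq nat) :
  (forall u v, prefix u v -> T v -> T u) ->
  (forall w k, T w -> k < size w -> nth 0 w k \in B k) ->
  (forall l, exists2 w, T w & size w = l) ->
  exists r : nat -> nat, forall l, T (mkseq r l).
Proof.
move=> preT boundT deepT.
pose deep w := forall m, exists2 u, size u = m & T (w ++ u).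
have deep_nil : deep [::] by move=> m; have [w] := deepT m; exists w.
have deep_rcons w : deep w -> exists a, deep (rcons w a).
  move=> dw; apply: contrapT => none.
  have [x m n le_m h u su|x xB|M hM] := @uniform_bound _ (B (size w))
      (fun a m => forall u, size u = m -> ~ T (rcons w a ++ u)).
  - move=> hT; apply: (h (take m u)); first by rewrite size_takel // su.
    by apply: preT hT; rewrite -{2}(cat_take_drop m u) catA prefix_prefix.
  - apply: contrapT => nox; apply: none; exists x => m; apply: contrapT => no.
    by apply: nox; exists m => u su hT; apply: no; exists u.
  have [[//|a u] [su] hT] := dw M.+1; apply: (hM a _ u su); last by rewrite cat_rcons.
  have := boundT _ (size w) hT; rewrite nth_cat ltnn subnn; apply.
  by rewrite size_cat /=; lia.
pose nxt w := xget 0 [set a | deep (rcons w a)].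
pose W n := iter n (fun w => rcons w (nxt w)) [::].
have deepW n : deep (W n).
  by elim: n => // n /deep_rcons/xgetPex; apply.
exists (fun n => nxt (W n)) => l.
have -> : mkseq (fun n => nxt (W n)) l = W l.
  by elim: l => // l IH; rewrite mkseqS IH.
by have [u /size0nil -> ] := deepW l 0; rewrite cats0.
Qed.

(* keeps closing tactics from running the simulated machines *)
#[local] Opaque fine_cover sim killed.

Section emptiness.
Variables (eD eK : nat) (kq : nat -> baire).
Hypothesis kqP : forall i, Phi eK (nth 0 [:: i]) (kq i).
Hypothesis fineP : forall i k, exists n, fine_cover k (kq i n).

Definition first_fine (i k : nat) : nat := kq i (ex_minn (fineP i k)).

Definition in_product (i : nat) (r : nat -> nat) : Prop :=
  forall k, r k \in centers (first_fine i k).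

Lemma mkseq_pad (l : seq nat) s : mkseq (nth 0 l) (size l + s) = l ++ nseq s 0.
Proof.
apply: (@eq_from_nth _ 0) => [|i]; first by rewrite size_mkseq size_cat size_nseq.
rewrite size_mkseq => lt_i; rewrite nth_mkseq // nth_cat nth_nseq if_same.
by case: ltnP => // h; rewrite nth_default.
Qed.

Lemma fine_coversE i k s : exists N,
  fine_covers eK i k s = [seq v <- mkseq (kq i) N | fine_cover k v] /\
  N = size (sim eK (i :: nseq s 0)).
Proof.
have := sim_Phi (size [:: i] + s) (kqP i); rewrite mkseq_pad /= => E.
by exists (size (sim eK (i :: nseq s 0))); rewrite /fine_covers -E.
Qed.

(** The outputs seen at different stages are prefixes of one sequence, so the first
    fine cover does not depend on the stage at which it is seen. *)
Lemma fine_covers_head i k s : ~~ nilp (fine_covers eK i k s) ->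
  head 0 (fine_covers eK i k s) = first_fine i k.
Proof.
have [N [-> _]] := fine_coversE i k s; rewrite /first_fine.
case: ex_minnP => n0 hn0 min_n0.
have h0 m : m <= n0 -> [seq v <- mkseq (kq i) m | fine_cover k v] = [::].
  elim: m => [|m IH] lt_m. by [].
  rewrite mkseqS filter_rcons.
  rewrite IH; last exact: ltnW.
  case E: (fine_cover k (kq i m)).
  have := min_n0 _ E. rewrite leqNgt lt_m. by [].
  by [].
have [lt_N|le_N] := ltnP n0 N; last by rewrite h0.
rewrite /mkseq -(subnKC lt_N) iotaD map_cat filter_cat -/(mkseq _ _).
by rewrite mkseqS filter_rcons h0 ?leqnn // hn0.
Qed.

Lemma fine_covers_eventually i k : exists s0, forall s, s0 <= s ->
  ~~ nilp (fine_covers eK i k s).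
Proof.
have [n0 hn0] := fineP i k.
have [s0 hs0] := sim_Phi_size n0.+1 (kqP i).
exists s0 => s le_s; have [N [-> EN]] := fine_coversE i k s.
have lt_N : n0 < N.
  rewrite EN (leq_trans hs0) //.
  have := mkseq_pad [:: i] s; rewrite [_ ++ _]/= => <-.
  apply: size_prefix; apply: sim_prefix; apply: prefix_mkseq.
  by rewrite add1n ltnW.
rewrite /nilp size_filter -lt0n -has_count; apply/hasP; exists (kq i n0) => //.
by apply/mapP; exists n0; rewrite ?mem_iota.
Qed.

Definition empty_piece (p : nat -> nat) (i : nat) (b : seq nat) : Prop :=
  exists s, refuted eD eK p i b s.

Lemma empty_piece_kills p i b r : empty_piece p i b -> in_product i r ->
  exists s l, killed eD p b s (mkseq r l).
Proof.
move=> [s /hasP[l _ /andP[/allP known /allP kills]]] hr.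
exists s, l; apply: kills; rewrite mem_words size_mkseq eqxx.
apply/allP => k hk; rewrite fine_covers_head ?known //.
by move: hk; rewrite mem_iota => /andP[_ lt_k]; rewrite nth_mkseq.
Qed.

(** Each word that is removed is removed at a finite stage and on account of finitely
    many of the sets to be avoided.  If all words of some length were removed, one
    stage would do for all of them, since these words are finitely many, and it would
    be a certificate.  So words of all lengths remain, and Koenig's lemma applies. *)
Lemma nonempty_piece p i (b : nat -> nat) :
  (forall n, ~ empty_piece p i (mkseq b n)) ->
  exists2 r, in_product i r & forall n s l, ~~ killed eD p (mkseq b n) s (mkseq r l).
Proof.
move=> hb.
pose T w := (forall k, k < size w -> nth 0 w k \in centers (first_fine i k)) /\
            (forall n s, ~~ killed eD p (mkseq b n) s w).
have [u v hu [h1 h2]|w k [h1 _] /h1|l|r hr] := @koenig T (fun k =>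
  centers (first_fine i k)).
- split=> [k lt_k|n s]; last by apply: contra (h2 n s);
  apply: killed_prefix (prefix_refl _) _ hu.
  by rewrite -(prefix_nth _ hu lt_k) h1 // (leq_trans lt_k) ?size_prefix.
- by [].
- have [k m n le_m h s le_s|k _|s0 hs0] := @uniform_bound _ (iota 0 l)
    (fun k s0 => forall s, s0 <= s -> ~~ nilp (fine_covers eK i k s)).
  + by apply: h; apply: leq_trans le_s.
  + exact: fine_covers_eventually.
  apply: contrapT => none.
  pose ws := words eK i s0 l.
  have wordsE s w : s0 <= s -> (w \in words eK i s l) =
      (size w == l) && all (fun k => nth 0 w k \in centers (first_fine i k)) (iota 0 l).
    move=> le_s; rewrite mem_words; congr (_ && _); apply: eq_in_all => k hk.
    by rewrite fine_covers_head ?hs0.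
  have [w m n le_m|w|N hN] := @uniform_bound _ ws (fun w n =>
    killed eD p (mkseq b n) n w).
  + by apply: killed_prefix (prefix_mkseq _ le_m) le_m (prefix_refl _).
  + rewrite wordsE // => /andP[/eqP sw /allP hw].
    apply: contrapT => alive; apply: none; exists w => //; split=> [k|n s].
      by rewrite sw => lt_k; apply: hw; rewrite mem_iota.
    apply/negP => h; apply: alive; exists (maxn n s).
    by apply: killed_prefix h; rewrite ?prefix_mkseq ?leq_maxl ?leq_maxr ?prefix_refl.
  apply: (hb N); exists (maxn (maxn s0 N) l); apply/hasP; exists l.
    by rewrite mem_iota /= ltnS leq_maxr.
  apply/andP; split; apply/allP.
    by move=> k hk; apply: hs0 => //; rewrite -maxnA leq_maxl.
  move=> w; rewrite wordsE; last by rewrite -maxnA leq_maxl.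
  rewrite -(wordsE s0) // => /hN; apply: killed_prefix; rewrite ?prefix_refl //.
  by rewrite maxnAC leq_maxr.
exists r => [k|n s l]; last by have [_] := hr l; apply.
by have [h _] := hr k.+1; have := h k; rewrite size_mkseq nth_mkseq //; apply.
Qed.

End emptiness.

#[local] Transparent fine_cover killed.

(** * Compact sets and distances in a computable metric space *)

Import Order.TTheory GRing.Theory Num.Theory.
Import numFieldNormedType.Exports.
Local Open Scope classical_set_scope.
Local Open Scope ring_scope.

Section rationals.
Variable R : realType.

Lemma ratr_rat_of v : ratr (rat_of v) =
  ((nunpair (nunpair v).1).1%:R - (nunpair (nunpair v).1).2%:R)
    / (nunpair v).2.+1%:R :> R.
Proof.
rewrite /rat_of; case: (nunpair v) => k m; rewrite /fst /snd.
case: (nunpair k) => i j.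
by rewrite fmorph_div /= rmorphB /= !ratr_nat.
Qed.

Lemma exceedsE j m v :
  exceeds j m v = (2 ^- m + 2 ^- j.+1 < ratr (rat_of v) :> R).
Proof.
rewrite ratr_rat_of /exceeds.
move: (nunpair (nunpair v).1).1 (nunpair (nunpair v).1).2 (nunpair v).2 => x y d.
have d0 : 0 < d.+1%:R :> R by rewrite ltr0n.
have m0 : 0 < 2 ^+ m :> R by rewrite exprn_gt0.
have j0 : 0 < 2 ^+ j.+1 :> R by rewrite exprn_gt0.
rewrite expnD -(ltr_nat R) !(natrD, natrM, natrX).
rewrite ltr_pdivlMr // -[RHS](ltr_pM2r (mulr_gt0 m0 j0)).
have -> : (2 ^- m + 2 ^- j.+1) * d.+1%:R * (2 ^+ m * 2 ^+ j.+1) =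
   d.+1%:R * (2 ^+ j.+1 + 2 ^+ m) :> R by field; rewrite !gt_eqF.
by rewrite mulrBl ltrBrDl.
Qed.

Lemma small_radiusE k j :
  small_radius k j = (ratr (rat_of j) <= 2 ^- k.+2 :> R).
Proof.
rewrite ratr_rat_of /small_radius.
move: (nunpair (nunpair j).1).1 (nunpair (nunpair j).1).2 (nunpair j).2 => x y d.
have d0 : 0 < d.+1%:R :> R by rewrite ltr0n.
have k0 : 0 < 2 ^+ k.+2 :> R by rewrite exprn_gt0.
rewrite -(ler_nat R) !(natrD, natrM, natrX) ler_pdivrMr //.
by rewrite [2 ^- _ * _]mulrC ler_pdivlMr // mulrBl lerBlDl.
Qed.

Lemma pow2_half k : 2 ^- k.+1 = 2 ^- k / 2 :> R.
Proof. by rewrite exprS invfM mulrC. Qed.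

Lemma pow2_gt0 k : 0 < 2 ^- k :> R.
Proof. by rewrite invr_gt0 exprn_gt0. Qed.

Lemma pow2_le m n : (m <= n)%N -> 2 ^- n <= 2 ^- m :> R.
Proof. by move=> h; rewrite lef_pV2 ?posrE ?exprn_gt0 // ler_weXn2l // ler1n. Qed.

Lemma pow2_small (e : R) : 0 < e -> exists n, 2 ^- n < e.
Proof.
move=> e0; have [N _ h] := near_infty_natSinv_expn_lt (PosNum e0).
by exists N; have := h N (leqnn N); rewrite /= div1r.
Qed.

End rationals.

Section metric.
Variables (R : realType) (X : metricType R) (alpha : nat -> X).
Implicit Types (x y : X).

Lemma cvg_pow2 (u : nat -> X) x :
  (forall i, mdist (u i) x < 2 ^- i) -> u @ \oo --> x.
Proof.
move=> h; apply/cvg_ballP => e e0; have [N hN] := pow2_small e0.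
exists N => // i /= le_i; rewrite ballEmdist /= metric_sym.
by rewrite (lt_le_trans (h i)) // (le_trans (pow2_le _ le_i)) // ltW.
Qed.

Lemma cauchy_rep_dist p x j : cauchy_rep alpha p x -> mdist (alpha (p j)) x <= 2 ^- j.
Proof.
move=> [hc /cvg_ballP hl]; apply/ler_addgt0Pl => e e0.
have [N _ hN] := hl e e0; pose i := maxn N j.+1.
have := hN i (leq_maxl _ _); rewrite /= ballEmdist /= metric_sym => h1.
have h2 := hc i j (leq_maxr _ _).
rewrite addrC; apply: le_trans (metric_triangle _ (alpha (p i)) _) _.
by rewrite lerD // ?(ltW h1) // metric_sym ltW.
Qed.

End metric.

Section names.
Variables (R : realType) (X : metricType R) (alpha : nat -> X).
Implicit Types (x y : X).

Lemma mdist_real (a b : R) : @mdist R (R^o : metricType R) a b = `|a - b|.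
Proof.
set d := mdist _ _; have E e : (d < e) = (`|a - b| < e).
  apply/idP/idP => h.
    have : ball (a : R^o) e b by rewrite ballEmdist.
    by rewrite -ball_normE.
  have : ball (a : R^o) e b by rewrite -ball_normE.
  by rewrite ballEmdist.
by apply/eqP; rewrite eq_le !leNgt -(E d) (E `|a - b|) !ltxx.
Qed.

Lemma metric_ball_open x e : open (ball x e).
Proof.
rewrite openE => y; rewrite ballEmdist /= => h.
apply/nbhs_ballP; exists (e - mdist x y); first by rewrite /= subr_gt0.
move=> z; rewrite ballEmdist /= => hz.
by rewrite (le_lt_trans (metric_triangle _ y _)) // -ltrBrDl.
Qed.

Section distances.
Variable eD : nat.
Hypothesis distP : forall a b, exists2 q, Phi eD (nth 0%N [:: a; b]) q &
  rep_real q (mdist (alpha a) (alpha b)).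

Lemma far_dist s a b j : far eD s a b j -> 2 ^- j.+1 < mdist (alpha a) (alpha b).
Proof.
have [q hq hr] := distP a b => /hasP[m]; rewrite mem_iota => /andP[_ lt_m].
have E := sim_Phi (2 + s) hq; rewrite (mkseq_pad [:: a; b]) in E.
rewrite E nth_mkseq // (exceedsE R) => h.
have := cauchy_rep_dist m hr; rewrite mdist_real => /ler_normlP[_]; lra.
Qed.

Lemma dist_far a b j : 2 ^- j.+1 < mdist (alpha a) (alpha b) ->
  exists s, far eD s a b j.
Proof.
move=> h; have [q hq hr] := distP a b.
have [|m hm] := @pow2_small R ((mdist (alpha a) (alpha b) - 2 ^- j.+1) / 2).
  by rewrite divr_gt0 // subr_gt0.
have [s hs] := sim_Phi_size m.+1 hq; exists s.
have E := sim_Phi (2 + s) hq; rewrite (mkseq_pad [:: a; b]) in E.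
have lt_m : (m < size (sim eD [:: a, b & nseq s 0%N]))%N.
  rewrite (leq_trans hs) //; apply: size_prefix; apply: sim_prefix.
  by rewrite -[X in prefix _ X](mkseq_pad [:: a; b] s) prefix_mkseq // leq_addl.
apply/hasP; exists m; first by rewrite mem_iota.
rewrite E nth_mkseq // (exceedsE R).
have := cauchy_rep_dist m hr; rewrite mdist_real => /ler_normlP[]; lra.
Qed.

End distances.

Lemma compact_sequence (K : set X) (y : nat -> X) :
  compact K -> (forall n, K (y n)) ->
  exists2 x, K x & forall e N, 0 < e -> exists2 m, (N <= m)%N & mdist x (y m) < e.
Proof.
move=> cK Ky.
have [|x [Kx clx]] := cK (y @ \oo) _.
  by exists 0%N => // n _; apply: Ky.
exists x => // e N e0.
have [||z [[m le_m <-] hz]] := clx [set y m | m in [set m | (N <= m)%N]] (ball x e).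
- by exists N => // m le_m; exists m.
- exact: nbhsx_ballx.
by exists m => //; move: hz; rewrite ballEmdist.
Qed.

Lemma dense_near x e : dense (range alpha) -> 0 < e ->
  exists i, mdist (alpha i) x < e.
Proof.
move=> dense_alpha e0.
have [|y [hy [i _ ei]]] := dense_alpha (ball x e) _ (@metric_ball_open _ _).
  by exists x; apply: ballxx.
by exists i; move: hy; rewrite ballEmdist /= metric_sym ei.
Qed.

(** Otherwise choose points of [K] outside the first [N] balls, for each [N]; they
    cluster at a point that lies in one of the balls. *)
Lemma compact_balls (K : set X) e : compact K -> dense (range alpha) -> 0 < e ->
  exists N, forall x, K x -> exists2 i, (i < N)%N & mdist (alpha i) x < e.
Proof.
move=> cK dense_alpha e0; apply: contrapT => no.
have /choice[y hy] : forall N, exists x, K x /\ forall i, (i < N)%N ->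
  e <= mdist (alpha i) x.
  move=> N; apply: contrapT => nox; apply: no; exists N => x Kx.
  apply: contrapT => noi; apply: nox; exists x; split=> // i lt_i.
  by rewrite leNgt; apply/negP => h; apply: noi; exists i.
have [x Kx hx] := compact_sequence cK (fun n => (hy n).1).
have [i hi] := dense_near x dense_alpha e0.
have [|m lt_m hm] := hx (e - mdist (alpha i) x) i.+1; first by rewrite subr_gt0.
have := (hy m).2 i lt_m; rewrite leNgt => /negP; apply.
by apply: le_lt_trans (metric_triangle _ x _) _; rewrite -ltrBrDl.
Qed.

Section covers.
Variables (K : set X) (q : baire).
Hypothesis kappaP : kappa alpha q K.

(** Balls of radius exactly [2 ^- k.+2] around the centres cover [K]; from a finite
    subcover drop the balls that miss [K], since kappa-names list only covers by balls
    that meet [K]. *)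
Lemma exists_fine_cover k : dense (range alpha) -> exists n, fine_cover k (q n).
Proof.
move=> dense_alpha; have [cK codeP] := kappaP.
pose rho := npair (npair 1 0) (2 ^ k.+2).-1.
have rhoE : ratr (rat_of rho) = 2 ^- k.+2 :> R.
  rewrite ratr_rat_of /rho npairK /fst npairK /snd prednK ?expn_gt0 //.
  by rewrite subr0 div1r natrX.
have [N hN] := compact_balls cK dense_alpha (pow2_gt0 R k.+2).
pose l := [seq npair i rho | i <- iota 0 N & `[< rball alpha (npair i rho) `&` K
  !=set0 >]].
have rballE i : rball alpha (npair i rho) = ball (alpha i) (2 ^- k.+2).
  by rewrite /rball npairK rhoE.
have [|n hn] := (codeP (CodeSeq.code l)).2.
  rewrite /min_cover_code CodeSeq.codeK; split=> [x Kx|c].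
    have [i lt_i hi] := hN x Kx.
    have hb : rball alpha (npair i rho) x by rewrite rballE ballEmdist.
    exists (npair i rho) => //.
    apply/mapP; exists i => //; rewrite mem_filter mem_iota lt_i andbT.
    by rewrite leq0n andbT; apply/asboolP; exists x.
  by move=> /mapP[i]; rewrite mem_filter => /andP[/asboolP h _] ->.
exists n; rewrite hn /fine_cover CodeSeq.codeK; apply/allP => c /mapP[i _ ->].
by rewrite npairK (small_radiusE R) rhoE.
Qed.

Lemma center_near k n a : fine_cover k (q n) -> a \in centers (q n) ->
  exists2 y, K y & mdist (alpha a) y < 2 ^- k.+2.
Proof.
have [_ codeP] := kappaP; move=> /allP fine /mapP[c hc ->].
have [_ h] : min_cover_code alpha K (q n) by have [h _] := codeP (q n); apply: h;
  exists n.
have [y [hy Ky]] := h c hc; exists y => //; move: hy; rewrite /rball.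
have := fine c hc; rewrite (small_radiusE R); case: (nunpair c) => i j /= le_j.
by rewrite ballEmdist /= => /lt_le_trans; apply.
Qed.

Lemma near_center k n x : fine_cover k (q n) -> K x ->
  exists2 a, a \in centers (q n) & mdist (alpha a) x < 2 ^- k.+2.
Proof.
have [_ codeP] := kappaP; move=> /allP fine Kx.
have [h _] : min_cover_code alpha K (q n) by have [h _] := codeP (q n); apply: h;
  exists n.
have [c hc hx] := h x Kx; exists (nunpair c).1; first exact: map_f.
move: hx; rewrite /rball.
have := fine c hc; rewrite (small_radiusE R); case: (nunpair c) => i j /= le_j.
by rewrite ballEmdist /= => /lt_le_trans; apply.
Qed.

End covers.

End names.

(** * Branches are names of points *)

Section names_in_product.
Variables (R : realType) (X : metricType R) (alpha : nat -> X) (eD : nat).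
Hypothesis distP : forall a b, exists2 q, Phi eD (nth 0%N [:: a; b]) q &
  rep_real q (mdist (alpha a) (alpha b)).
Variables (K : set X) (q : baire) (S : nat -> nat).
Hypothesis kappaP : kappa alpha q K.
Hypothesis SP : forall k, exists2 n, S k = q n & fine_cover k (q n).

(** The centres lie close to points [y k] of [K], which have a cluster point [x] in [K];
    the bounds on the distances of the centres make them converge to [x]. *)
Lemma product_name (r : nat -> nat) :
  (forall k, r k \in centers (S k)) ->
  (forall s l, ~~ not_cauchy eD s (mkseq r l)) ->
  exists2 x, K x & cauchy_rep alpha r x.
Proof.
move=> hr cauchy_r.
have close i j : (j < i)%N -> mdist (alpha (r i)) (alpha (r j)) <= 2 ^- j.+1.
  move=> lt_ji; rewrite leNgt; apply/negP => /(dist_far distP)[s far_s].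
  have /negP := cauchy_r s i.+1; apply; apply/hasP; exists i.
    by rewrite mem_iota size_mkseq ltnS leqnn.
  apply/hasP; exists j; first by rewrite mem_iota.
  by rewrite !nth_mkseq // ltnS ltnW.
have /choice[y hy] : forall k, exists y, K y /\ mdist (alpha (r k)) y < 2 ^- k.+2.
  move=> k; have [n Sk fine] := SP k.
  by have := hr k; rewrite Sk => /(center_near kappaP fine)[y]; exists y.
have [x Kx hx] := compact_sequence kappaP.1 (fun n => (hy n).1).
exists x => //; split=> [i j lt_ji|].
  apply: le_lt_trans (close i j lt_ji) _.
  by rewrite pow2_half ltr_pdivrMr // ltr_pMr ?pow2_gt0 // ltr1n.
apply: cvg_pow2 => i; have [m lt_m hm] := hx _ i.+1 (pow2_gt0 R i.+2).
have h1 := close m i lt_m; have h2 := (hy m).2.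
have h3 : 2 ^- m.+2 <= 2 ^- i.+2 :> R by apply: pow2_le; rewrite !ltnS ltnW.
have h4 := metric_triangle (alpha (r i)) (alpha (r m)) x.
have h5 := metric_triangle (alpha (r m)) (y m) x.
rewrite metric_sym in h1; rewrite metric_sym in hm.
have := pow2_half R i; have := pow2_half R i.+1; lra.
Qed.

(** Pick at each level a ball that contains [x]: centres with distances less than
    [2 ^- i.+2] and [2 ^- j.+2] from [x] are at most [2 ^- j.+1] apart if [j < i]. *)
Lemma name_in_product x : K x -> exists r : nat -> nat,
  [/\ forall k, r k \in centers (S k), cauchy_rep alpha r x &
      forall s l, ~~ not_cauchy eD s (mkseq r l)].
Proof.
move=> Kx.
have /choice[r hr] : forall k, exists a,
    a \in centers (S k) /\ mdist (alpha a) x < 2 ^- k.+2.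
  move=> k; have [n -> fine] := SP k.
  by have [a ha hax] := near_center kappaP fine Kx; exists a.
have close i j : (j < i)%N -> mdist (alpha (r i)) (alpha (r j)) <= 2 ^- j.+1.
  move=> lt_ji; have h1 := (hr i).2; have h2 := (hr j).2.
  have h3 : 2 ^- i.+2 <= 2 ^- j.+2 :> R by apply: pow2_le; rewrite !ltnS ltnW.
  have h4 := metric_triangle (alpha (r i)) x (alpha (r j)).
  rewrite metric_sym in h2; have := pow2_half R j.+1; lra.
exists r; split=> [k||s l]; first by have [] := hr k.
- split=> [i j lt_ji|].
    apply: le_lt_trans (close i j lt_ji) _.
    by rewrite pow2_half ltr_pdivrMr // ltr_pMr ?pow2_gt0 // ltr1n.
  apply: cvg_pow2 => i; apply: lt_le_trans (hr i).2 _.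
  by apply: pow2_le; rewrite -addn2 leq_addr.
- apply/negP => /hasP[i]; rewrite mem_iota size_mkseq => /andP[_ lt_i] /hasP[j].
  rewrite mem_iota => /andP[_ lt_j].
  rewrite !nth_mkseq ?(ltn_trans lt_j) // => /(far_dist distP).
  by rewrite ltNge close.
Qed.

End names_in_product.

Lemma interleave_mkseq (q r : baire) l :
  interleave q (mkseq r l) = mkseq (bpair q r) l.*2.
Proof.
rewrite /interleave size_mkseq.
have -> : [seq [:: q k; nth 0%N (mkseq r l) k] | k <- iota 0 l]
        = [seq [:: q k; r k] | k <- iota 0 l].
  apply/eq_in_map => k; rewrite mem_iota => /andP[_ lt_k].
  by rewrite nth_mkseq.
elim: l => // l IH; rewrite -[l.+1 in LHS]addn1 iotaD map_cat flatten_cat IH /=.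
rewrite doubleS !mkseqS -!cats1 -catA /=; congr (_ ++ [:: _; _]);
  by rewrite /bpair add0n /= odd_double /= ?uphalf_double ?doubleK.
Qed.

Lemma outsideP (R : realType) (X : metricType R) (alpha : nat -> X)
    (p : baire) (A : set X) (r : baire) x :
  psi_minus (cauchy_rep alpha) p A -> cauchy_rep alpha r x ->
  ~ A x <-> exists l, outside p (mkseq r l).
Proof.
move=> [_ [_ real]] hx; have [||q' hq' [y hy ey]] := real r x => //.
  by exists (char_fun (~` A) x).
have chiE : char_fun (~` A) x = true <-> ~ A x by split => [/asboolP|/asboolP].
apply: iff_trans (iff_sym chiE) _; rewrite -ey; apply: iff_trans hy _.
have E l : outside p (mkseq r l) = (0%N \in sim (p 0%N) (mkseq (bpair (fun k =>
  p k.+1) r) l.*2)).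
  by rewrite /outside interleave_mkseq.
split=> [[n hn]|[l]]; last first.
  by rewrite E (sim_Phi _ hq') => /mapP[n _ ->]; exists n.
have [s hs] := sim_Phi_size n.+1 hq'; exists s; rewrite E.
have hp := sim_prefix (p 0%N) (prefix_mkseq (bpair (fun k => p k.+1) r) (leq_addr s s)).
rewrite -addnn; apply: prefix_mem hp _.
by rewrite (sim_Phi _ hq'); apply/mapP; exists n; rewrite ?mem_iota.
Qed.

Lemma entersP m (r : baire) :
  ce_open m r <-> exists s l, enters m s (mkseq r l).
Proof.
have padE w s : [:: CodeSeq.code w] ++ nseq s 0%N
    = mkseq (fun k => if k is 0%N then CodeSeq.code w else 0%N) s.+1.
  apply: (@eq_from_nth _ 0%N) => [|[|i]]; rewrite size_cat size_nseq ?size_mkseq //.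
  by move=> lt_i; rewrite nth_mkseq // nth_cat /= nth_nseq if_same.
split=> [[w hw ew]|[s [l /hasP[i _]]]].
  have [s hs] := (halts_sim _ _).1 hw; exists s, (size w).
  apply/hasP; exists (size w); first by rewrite mem_iota size_mkseq /=.
  rewrite -ew take_size; move: hs.
  by apply: sim_halts_prefix; rewrite -[_ :: _]/([:: _] ++ _) padE prefix_mkseq.
rewrite -[_ :: _]/([:: _] ++ _) padE => h; exists (take i (mkseq r l)).
  by apply/halts_sim; exists s.+1.
rewrite /mkseq -map_take take_iota size_map size_iota.
by [].
Qed.

(** * The low point *)

Local Close Scope ring_scope.

Lemma baire_lim_eventually (p q : baire) :
  (forall n, exists T, forall t, T <= t -> p (npair t n) = q n) -> baire_lim p q.
Proof.
move=> h; apply/pointwise_cvgP => n W /nbhs_singleton Wq.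
have [T hT] := h n; exists T => // t le_t /=.
by rewrite /bproj hT.
Qed.

(** [i0] is the first piece whose tree has a branch. *)
Section low_point.
Variables (eD eK : nat) (kq : nat -> baire).
Hypothesis kqP : forall i, Phi eK (nth 0 [:: i]) (kq i).
Hypothesis fineP : forall i k, exists n, fine_cover k (kq i n).
Variable p : baire.

Local Notation empty := (empty_piece eD eK p).

Lemma seenP t i b : seen_empty eD eK p t i b -> empty i b.
Proof. by move=> /hasP[s _ h]; exists s. Qed.

Lemma seen_eventually i b : empty i b ->
  exists T, forall t, T <= t -> seen_empty eD eK p t i b.
Proof.
move=> [s h]; exists s => t le_t; apply/hasP; exists s => //.
by rewrite mem_iota ltnS.
Qed.

Variable i0 : nat.
Hypothesis i0P : ~ empty i0 [::].
Hypothesis i0_min : forall i, i < i0 -> empty i [::].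

Lemma piece_eventually : exists T, forall t, T <= t -> current_piece eD eK p t = i0.
Proof.
have [i m n le_mn h t le_t|i|T hT] := @uniform_bound _ (iota 0 i0)
    (fun i T => forall t, T <= t -> seen_empty eD eK p t i [::]).
- by apply: h; apply: leq_trans le_t.
- by rewrite mem_iota => /andP[_ lt_i]; apply/seen_eventually/i0_min.
exists (maxn T i0) => t; rewrite geq_max => /andP[le_T le_i].
rewrite /current_piece -(subnKC le_i) -addnS iotaD filter_cat add0n subnKC //.
have /eqP -> : [seq i <- iota 0 i0 | ~~ seen_empty eD eK p t i [::]] == [::].
  rewrite -[_ == _]negbK -has_filter; apply/hasPn => i hi.
  by rewrite negbK hT.
have nseen : ~~ seen_empty eD eK p t i0 [::].
  apply/negP => /seenP; exact: i0P.
have hd (a : pred nat) x s : a x -> head 0 (seq.filter a (x :: s)) = x by move=> /= ->.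
exact: hd nseen.
Qed.

Definition next_bit (b : seq nat) : nat := `[< empty i0 (b ++ [:: 0]) >].

Definition limit_bits (n : nat) : seq nat :=
  iter n (fun b => b ++ [:: next_bit b]) [::].

Definition limit_bit (n : nat) : nat := next_bit (limit_bits n).

Lemma limit_bitsE n : limit_bits n = mkseq limit_bit n.
Proof. by elim: n => // n IH; rewrite mkseqS -cats1 -IH. Qed.

Lemma guess_eventually b : exists T, forall t, T <= t ->
  guess eD eK p t b = next_bit b.
Proof.
have [T hT] := piece_eventually; rewrite /next_bit.
have [e|ne] := pselect (empty i0 (b ++ [:: 0])).
  have [T' hT'] := seen_eventually e; exists (maxn T T') => t.
  rewrite geq_max => /andP[le_T le_T']; rewrite /guess (hT _ le_T) (hT' _ le_T').
  by congr nat_of_bool; apply/esym/asboolP.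
exists T => t le_T; rewrite /guess (hT _ le_T); congr nat_of_bool.
by apply/idP/asboolP => [/seenP|/ne]; exact: id.
Qed.

Lemma bits_eventually n : exists T, forall t, T <= t ->
  bits eD eK p t n = limit_bits n.
Proof.
elim: n => [|n [T hT]]; first by exists 0.
have [T' hT'] := guess_eventually (limit_bits n).
exists (maxn T T') => t; rewrite geq_max => /andP[le_T le_T'].
rewrite /bits iterS -/(bits eD eK p t n) (hT _ le_T) (hT' _ le_T').
exact: erefl.
Qed.

Lemma output_lim : baire_lim (stream (output eD eK) p) limit_bit.
Proof.
apply: baire_lim_eventually => n.
have [T hT] := bits_eventually n; have [T' hT'] := guess_eventually (limit_bits n).
exists (maxn T T') => t; rewrite geq_max => /andP[le_T le_T'].
by rewrite stream_output (hT _ le_T) (hT' _ le_T').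
Qed.

Lemma enters_some_cat b m s w : enters_some (b ++ [:: m]) s w =
  enters_some b s w || ((m == 0) && enters (size b) s w).
Proof.
rewrite /enters_some size_cat addn1 -[(size b).+1]addn1 iotaD has_cat /=.
rewrite add0n nth_cat ltnn subnn orbF; congr orb.
apply: eq_in_has => k; rewrite mem_iota => /andP[_ lt_k].
by rewrite nth_cat lt_k.
Qed.

Lemma killed_cat b m s w : killed eD p (b ++ [:: m]) s w =
  killed eD p b s w || ((m == 0) && enters (size b) s w).
Proof.
rewrite /killed enters_some_cat.
by case: outside; case: enters_some; case: not_cauchy; rewrite //= ?orbT ?orbF.
Qed.

(** A bit other than 0 imposes no set to avoid. *)
Lemma empty_piece_cat i b m : m != 0 -> empty i (b ++ [:: m]) -> empty i b.
Proof.
move=> /negPf m0 [s h]; exists s.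
suff -> : refuted eD eK p i b s = refuted eD eK p i (b ++ [:: m]) s by [].
apply: eq_has => l; congr andb; apply: eq_all => w.
by rewrite killed_cat m0 orbF.
Qed.

(** A bit is 0 only if the tree keeps a branch, and a bit 1 removes no word. *)
Lemma limit_nonempty n : ~ empty i0 (mkseq limit_bit n).
Proof.
elim: n => [//|n IH]; rewrite mkseqS -cats1.
rewrite {2}/limit_bit limit_bitsE /next_bit.
case: asboolP => [_|//]; by move/empty_piece_cat => /(_ isT).
Qed.

(** A branch that survives all bits enters no [U_n] with bit 0; if bit [n] is 1, then
    some word of the branch is removed by the earlier bits together with 0 at [n],
    and only by entering [U_n] can this be. *)
Lemma low_point : exists r : baire,
  [/\ in_product fineP i0 r, jump r = limit_bit,
      forall l, ~~ outside p (mkseq r l) &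
      forall s l, ~~ not_cauchy eD s (mkseq r l)].
Proof.
have [r prod_r alive] := nonempty_piece kqP fineP limit_nonempty.
exists r; split=> //.
- apply/funext => n; rewrite /jump /limit_bit limit_bitsE /next_bit; congr nat_of_bool.
  apply/asboolP/asboolP => [/entersP[s [l h]]|/(empty_piece_kills kqP)/(_ prod_r)[s
    [l]]].
    apply: contrapT => ne; have /negP := alive n.+1 s l; apply.
    rewrite mkseqS -cats1 killed_cat size_mkseq h andbT.
    rewrite /limit_bit limit_bitsE /next_bit; case: asboolP => //= _.
    by rewrite orbT.
  rewrite killed_cat size_mkseq eqxx /= => /orP[h|h].
    by have := alive n s l; rewrite h.
  by apply/entersP; exists s, l.
- move=> l; have := alive 0 0 l; apply: contra; rewrite /killed => ->.
  by [].
- move=> s l; have := alive 0 s l; apply: contra; rewrite /killed => ->.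
  by rewrite !orbT.
Qed.

End low_point.

(** * Closed choice on a computable Ksigma-space *)

Lemma bpair_pad a b : nth 0 [:: a; b] = bpair (nth 0 [:: a]) (nth 0 [:: b]).
Proof.
apply/funext => -[|[|n]]; rewrite /bpair //= !nth_nil.
by case: (odd n) => //=; rewrite nth_nil.
Qed.

Lemma distance_machine (R : realType) (X : metricType R) (alpha : nat -> X) :
  computable_metric_space alpha ->
  exists e, forall a b, exists2 q, Phi e (nth 0 [:: a; b]) q &
    rep_real q (mdist (alpha a) (alpha b)).
Proof.
move=> [_ [F [e hF] [_ real]]]; exists e => a b.
have [||q Fq [y hy ey]] := real (nth 0 [:: a; b]) (a, b).
- by exists (nth 0 [:: a]), (nth 0 [:: b]); rewrite bpair_pad.
- by eexists.
by exists q; [exact: hF | rewrite -[mdist _ _]ey].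
Qed.

Lemma kappa_machine (R : realType) (X : metricType R) (alpha : nat -> X)
    (K : nat -> set X) :
  computable rep_nat (kappa alpha) (graph K) ->
  exists e (kq : nat -> baire), forall i, Phi e (nth 0 [:: i]) (kq i) /\
    kappa alpha (kq i) (K i).
Proof.
move=> [F [e hF] [_ real]]; exists e.
have /choice[kq h] : forall i, exists q, Phi e (nth 0 [:: i]) q /\ kappa alpha q (K i).
  move=> i; have [||q Fq [y hy ey]] := real (nth 0 [:: i]) i => //.
    by eexists.
  by exists q; split; [exact: hF | rewrite -ey].
by exists kq.
Qed.

Theorem corollary8p12 (R : realType) (X : metricType R) (alpha : nat -> X) :
  computable_Ksigma_space alpha ->
  low_computable (psi_minus (cauchy_rep alpha)) (cauchy_rep alpha)
    (closed_choice (cauchy_rep alpha)).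
Proof.
move=> [metric_alpha [K [_ _ cK coverK]]].
have [eD distP] := distance_machine metric_alpha.
have [eK [kq kqP]] := kappa_machine cK.
have kqPhi i := (kqP i).1.
have fineP i k : exists n, fine_cover k (kq i n).
  have [dense_alpha _] := metric_alpha.
  exact: (exists_fine_cover (kqP i).2 k dense_alpha).
have SP i k : exists2 n, first_fine fineP i k = kq i n & fine_cover k (kq i n).
  by exists (ex_minn (fineP i k)) => //; case: ex_minnP.
have [n hn] := stream_computable (regcomp_output eD eK).
(* this realizer is total: it writes guesses whatever its input is *)
exists (graph (stream (output eD eK))).
  by exists n => p _ ->; apply: hn.
split=> [p q q' -> -> //|p A pA [x [closedA Ax]]].
exists (stream (output eD eK) p) => //.
(* a piece that contains [x] has a tree with a branch, namely a name of [x] *)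
have [i0 i0P] : exists i, `[< ~ empty_piece eD eK p i [::] >].
  have [i _ Kx] : (\bigcup_i K i) x by rewrite coverK.
  exists i; apply/asboolP => /(empty_piece_kills kqPhi (fineP := fineP)) kills.
  have [r [prod_r name_r cauchy_r]] := name_in_product distP (kqP i).2 (SP i) Kx.
  have [s [l /or3P[out|//|]]] := kills r prod_r; last exact/negP/cauchy_r.
  by have /(outsideP pA name_r) : exists l, outside p (mkseq r l) by exists l.
have ex_i : exists i, `[< ~ empty_piece eD eK p i [::] >] by exists i0.
case: (ex_minnP ex_i) => i /asboolP ne_i min_i {i0P i0}.
have min_i' j : j < i -> empty_piece eD eK p j [::].
  by move=> lt_j; apply: contrapT => /asboolP/min_i; rewrite leqNgt lt_j.
have [r [prod_r jump_r inside cauchy_r]] := low_point kqPhi fineP ne_i.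
have [y Ky name_y] := product_name distP (kqP i).2 (SP i) prod_r cauchy_r.
have Ay : A y.
  apply: contrapT => /(outsideP pA name_y)[l].
  exact/negP/inside.
exists y; last by split=> //; case: pA.
exists r => //; exists (limit_bit eD eK p i) => //.
exact: (output_lim ne_i min_i').
Qed.
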